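(* (i) For every integer $m\ge 1$, $$ d(m)\le \sqrt{2}\, m \exp\left(-\sqrt{\log 2 \,\log m + (\log 2)^2/4}\right). $$ (ii) There exist an infinite set $\mathcal{M}$ of positive integers and a function $\varepsilon:\mathcal{M}\to\mathbb{R}$ with $\varepsilon(m)\to 0$ as $m\to\infty$, $m\in\mathcal{M}$, such that for all $m\in\mathcal{M}$ (large enough that the expression is defined) $$ f(m)\ge m^{1-(1+\varepsilon(m))\log\log\log m/\log\log m}. $$
   Context: For a positive integer $m$, let $\varphi(m)$ be Euler's function and $\lambda(m)$ the Carmichael function (the exponent of the multiplicative group $(\mathbb{Z}/m\mathbb{Z})^*$); recall $\lambda(m)=\mathrm{lcm}[\lambda(p_1^{r_1}),\dots,\lambda(p_k^{r_k})]$ for $m=p_1^{r_1}\cdots p_k^{r_k}$, with $\lambda(p^r)=p^{r-1}(p-1)$ except $\lambda(2^r)=2^{r-2}$ for $r\ge 3$. Let $\mathrm{rad}(m)$ be the product of the distinct primes dividing $m$. Let $\delta=2$ if $4\mid m$ and $\delta=1$ otherwise. Define $$ d(m)=\gcd\big(m,\ \delta\,\varphi(\mathrm{rad}(m))\big),\qquad f(m)=\gcd\big(m,\ \delta\,\lambda(m)\varphi(\mathrm{rad}(m))/\varphi(m)\big). $$ *)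

(* Defs.v *)
From mathcomp Require Import all_boot.
From Stdlib Require Import Reals.

Set Implicit Arguments.
Unset Strict Implicit.
Unset Printing Implicit Defensive.

Definition carmichael_pp (p r : nat) : nat :=
  if (p == 2) && (3 <= r) then 2 ^ (r - 2) else p ^ (r - 1) * (p - 1).

Definition carmichael (m : nat) : nat :=
  \big[lcmn/1]_(p <- primes m) carmichael_pp p (logn p m).

Definition rad (m : nat) : nat := \prod_(p <- primes m) p.

Definition delta (m : nat) : nat := if 4 %| m then 2 else 1.

Definition d_fun (m : nat) : nat := gcdn m (delta m * totient (rad m)).

(* delta * lambda(m) * phi(rad m) / phi(m) is an integer; %/ is exact here. *)
Definition f_fun (m : nat) : nat :=
  gcdn m ((delta m * carmichael m * totient (rad m)) %/ totient m).

(* Main.v *)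
Require Import Defs.
From Stdlib Require Import Reals.
From mathcomp Require Import all_boot all_order all_algebra zify ring lra Rstruct.
Set Implicit Arguments.
Unset Strict Implicit.
Unset Printing Implicit Defensive.
Import Order.TTheory GRing.Theory Num.Theory.

(* Upper bound for [d].  Put [n = m / d(m)].  An odd prime [q] of [m] not
   dividing [n] divides [phi(rad m)], hence [p - 1] for some prime [p] of [m].
   Deleting the largest prime of [m] and promoting the prime divisors of
   [p - 1] shows that the product of the odd primes of [m] is at most
   [2 ^ (u (u + 1) / 2)] with [u = log2 n]; since [d] divides
   [delta * phi(rad m)] this gives [log2 d <= (log2 n) ^ 2], which is the
   stated inequality after completing the square.

   Lower bound for [f].  For squarefree odd [m] one has
   [f(m) = gcd(m, lambda(m))], so [f(m)] contains every prime [q] of [m]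
   dividing [p - 1] for another prime [p] of [m].  Start from a random integer
   [n <= 2 ^ X] and let [m] be the product of all primes [> z] in the first [k]
   levels of the tree whose nodes below [p] are the prime divisors of [p - 1].
   Then [m / f(m) <= n].  Each level has product about [n] unless small primes,
   repeated primes or collisions occur.  By a sieve bound the sum of [1 / p]
   over primes [p = 1 mod q] up to [2 ^ X] is [O(log X) / q], so the expected
   losses are at most about [(C log X) ^ k], negligible against [X] while [k] is
   slightly smaller than [log X / log log X].  Thus some [n] yields
   [log m ~ k log n], while [log (m / f(m)) <= log n]. *)

Local Open Scope ring_scope.

(** * An upper bound sieve for primes in arithmetic progressions *)

Section Periodic.
Variable F : realFieldType.
Implicit Types (h g : nat -> F) (a b c : nat).

Definition periodic a h := forall c, h (c + a)%N = h c.

Lemma periodic_mul a h c j : periodic a h -> h (c + j * a)%N = h c.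
Proof.
move=> ph; elim: j => [|j IH]; first by rewrite mul0n addn0.
by rewrite mulSn [(a + _)%N]addnC addnA ph.
Qed.

Lemma periodic_mod a h c : periodic a h -> h (c %% a)%N = h c.
Proof. by move=> ph; rewrite {2}(divn_eq c a) addnC periodic_mul. Qed.

Lemma periodic_dvd a b h : (a %| b)%N -> periodic a h -> periodic b h.
Proof. by move=> /dvdnP[j ->] ph c; rewrite periodic_mul. Qed.

Lemma sum_progression a b h c : (0 < a)%N -> coprime a b -> periodic a h ->
  \sum_(j < a) h (c + j * b)%N = \sum_(j < a) h j.
Proof.
move=> a0 cab ph.
pose f (j : 'I_a) : 'I_a := Ordinal (ltn_pmod (c + j * b) a0).
have finj : injective f.
  move=> i j /(congr1 val) /= /eqP.
  rewrite eqn_modDl => /eqP E; apply/val_inj => /=.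
  wlog le : i j E / (i <= j)%N.
    by move=> W; case: (leqP i j) => H; [exact: W | rewrite (W j i) // ltnW].
  move/eqP: E; rewrite eq_sym eqn_mod_dvd ?leq_mul2r ?le ?orbT // -mulnBl Gauss_dvdl //.
  case: (posnP (j - i)) => [|p]; first by lia.
  by move/(dvdn_leq p); have := ltn_ord j; lia.
rewrite [RHS](reindex_inj finj) /=; apply: eq_bigr => j _.
by rewrite periodic_mod.
Qed.

Lemma sum_blocks a b h :
  \sum_(c < a * b) h c = \sum_(j < a) \sum_(c < b) h (c + j * b)%N.
Proof.
elim: a => [|a IH]; first by rewrite mul0n !big_ord0.
rewrite big_ord_recr /= -IH -!(big_mkord xpredT) mulSn addnC.
rewrite (@big_cat_nat _ _ _ (a * b)) ?leq_addr //=; congr (_ + _).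
by rewrite -{1}[(a * b)%N]add0n big_addn addKn !big_mkord.
Qed.

Lemma sum_crt a b h g : (0 < a)%N -> coprime a b -> periodic a h -> periodic b g ->
  \sum_(c < a * b) h c * g c = (\sum_(c < a) h c) * (\sum_(c < b) g c).
Proof.
move=> a0 cab ph pg.
rewrite (sum_blocks a b (fun c => h c * g c)) exchange_big /= mulr_sumr; apply: eq_bigr => c _.
rewrite -(sum_progression c a0 cab ph) mulr_suml; apply: eq_bigr => j _.
by rewrite (periodic_mul _ _ pg).
Qed.

Lemma sum_interval_le P h c0 T (M s : F) : (0 < P)%N -> periodic P h -> 0 <= s ->
  (forall c, `|h c| <= M) -> `|\sum_(c < P) h c| <= s ->
  `|\sum_(c < T) h (c0 + c)%N| <= T%:R / P%:R * s + P%:R * M.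
Proof.
move=> P0 ph s0 hM hs.
have M0 : 0 <= M by apply: le_trans (hM 0%N).
have shift u : \sum_(c < P) h (u + c)%N = \sum_(c < P) h c.
  rewrite -(@sum_progression P 1 h u) ?coprimen1 //.
  by apply: eq_bigr => c _; rewrite muln1.
rewrite -(big_mkord xpredT (fun c => h (c0 + c)%N)) {1}(divn_eq T P).
rewrite (@big_cat_nat _ _ _ (T %/ P * P)) ?leq_addr //= big_mkord.
rewrite (sum_blocks _ _ (fun c => h (c0 + c)%N)).
rewrite (eq_bigr (fun _ => \sum_(c < P) h c)); last first.
  move=> j _; rewrite -[RHS](shift c0); apply: eq_bigr => c _.
  by rewrite addnA periodic_mul.
rewrite sumr_const card_ord -{1}[(_ * P)%N]add0n big_addn addKn.
apply: le_trans (ler_normD _ _) _; apply: lerD.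
  rewrite normrMn -[leLHS]mulr_natl; apply: ler_pM => //.
  rewrite ler_pdivlMr ?ltr0n // -natrM ler_nat; exact: leq_divM.
apply: le_trans (ler_norm_sum _ _ _) _.
apply: le_trans (_ : \sum_(0 <= i < T %% P) M <= _).
  by apply: ler_sum => i _.
rewrite sumr_const_nat subn0 -[leLHS]mulr_natl ler_wpM2r // ler_nat ltnW // ltn_pmod //.
Qed.

End Periodic.

Section Sieve.
Variable F : realFieldType.
Variable d : nat.

(* For squarefree [e], [ramanujans (primes e) c] is the Ramanujan sum
   [c_e(c * d + 1)]. *)
Definition ramanujan (p c : nat) : F := if (p %| (c * d).+1)%N then p%:R - 1 else -1.
Definition ramanujans (s : seq nat) (c : nat) : F := \prod_(p <- s) ramanujan p c.

Lemma ramanujan_periodic p : periodic p (ramanujan p).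
Proof.
move=> c; rewrite /ramanujan mulnDl -addSn addnC dvdn_addr //.
exact: dvdn_mulr.
Qed.

Lemma ramanujans_periodic s : periodic (\prod_(p <- s) p) (ramanujans s).
Proof.
move=> c; rewrite /ramanujans; apply: eq_big_seq => p ps.
have /periodic_dvd : (p %| \prod_(p <- s) p)%N by rewrite (big_rem p) //= dvdn_mulr.
by apply; exact: ramanujan_periodic.
Qed.

Lemma ramanujan_norm p c : prime p -> `|ramanujan p c| <= p%:R.
Proof.
move=> pp; have p2 : (2 : F) <= p%:R by rewrite ler_nat prime_gt1.
by rewrite /ramanujan; case: ifP => _; rewrite ler_norml; lra.
Qed.

Lemma ramanujans_norm s c : all prime s -> `|ramanujans s c| <= (\prod_(p <- s) p)%:R.
Proof.
rewrite /ramanujans; elim: s => [|p s IH] /=; first by rewrite !big_nil normr1.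
move=> /andP[pp sp]; rewrite !big_cons normrM natrM.
by apply: ler_pM => //; [exact: ramanujan_norm | exact: IH].
Qed.

Lemma sum_dvd_progression p : prime p -> coprime p d ->
  \sum_(c < p) ((p %| (c * d).+1)%N : nat)%:R = 1 :> F.
Proof.
move=> pp cpd.
rewrite (eq_bigr (fun c : 'I_p => (fun x => ((p %| x)%N : nat)%:R) (1 + c * d)%N)) //.
rewrite (@sum_progression F p d (fun x => ((p %| x)%N : nat)%:R)) ?prime_gt0 //; last first.
  by move=> c; rewrite dvdn_addl.
rewrite (bigD1 (Ordinal (prime_gt0 pp))) //= dvdn0 big1 ?addr0 // => i ni.
case E: (p %| i)%N => //; exfalso; move: ni; rewrite -val_eqE /= -lt0n => /dvdn_leq/(_ E).
by have := ltn_ord i; lia.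
Qed.

Lemma sum_ramanujan p : prime p -> coprime p d -> \sum_(c < p) ramanujan p c = 0.
Proof.
move=> pp cpd.
rewrite (eq_bigr (fun c : 'I_p => p%:R * ((p %| (c * d).+1)%N : nat)%:R - 1)); last first.
  by move=> c _; rewrite /ramanujan; case: ifP => _ /=; ring.
by rewrite sumrB -mulr_sumr sum_dvd_progression // sumr_const card_ord mulr1 subrr.
Qed.

Lemma sum_ramanujan_sqr p : prime p -> coprime p d ->
  \sum_(c < p) ramanujan p c ^+ 2 = p%:R * (p%:R - 1).
Proof.
move=> pp cpd.
rewrite (eq_bigr (fun c : 'I_p => (p%:R * (p%:R - 2)) * ((p %| (c * d).+1)%N : nat)%:R + 1)); last first.
  by move=> c _; rewrite /ramanujan; case: ifP => _ /=; ring.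
by rewrite big_split /= -mulr_sumr sum_dvd_progression // sumr_const card_ord; ring.
Qed.

Lemma coprime_prod_primes p s : prime p -> all prime s -> p \notin s ->
  coprime p (\prod_(q <- s) q).
Proof.
move=> pp; elim: s => [|q s IH] /=; first by rewrite big_nil coprimen1.
move=> /andP[pq sp]; rewrite inE negb_or => /andP[npq nps].
by rewrite big_cons coprimeMr IH // prime_coprime // dvdn_prime2 // npq.
Qed.

Lemma prod_primes_gt0 s : all prime s -> (0 < \prod_(q <- s) q)%N.
Proof.
elim: s => [|p s IH] /=; first by rewrite big_nil.
by move=> /andP[pp /IH s0]; rewrite big_cons muln_gt0 prime_gt0.
Qed.

Lemma sum_ramanujans_sqr s : all prime s -> uniq s -> all (coprime^~ d) s ->
  0 <= \sum_(c < \prod_(p <- s) p) ramanujans s c ^+ 2 <= (\prod_(p <- s) p)%:R ^+ 2.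
Proof.
elim: s => [|p s IH] /=.
  by rewrite big_nil /ramanujans big_ord1 big_nil !expr1n ler01 lexx.
move=> /andP[pp sp] /andP[ps us] /andP[cp cs].
have /andP[I0 I1] := IH sp us cs.
rewrite big_cons natrM exprMn.
rewrite (eq_bigr (fun c : 'I_(p * _) => ramanujan p c ^+ 2 * ramanujans s c ^+ 2)); last first.
  by move=> c _; rewrite /ramanujans big_cons exprMn.
rewrite (sum_crt (h := fun c => ramanujan p c ^+ 2) (g := fun c => ramanujans s c ^+ 2)).
- have p2 : (2 : F) <= p%:R by rewrite ler_nat prime_gt1.
  rewrite sum_ramanujan_sqr //; apply/andP; split.
    by apply: mulr_ge0 => //; nra.
  by apply: ler_pM => //; nra.
- exact: prime_gt0.
- exact: coprime_prod_primes.
- by move=> c; rewrite ramanujan_periodic.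
- by move=> c; rewrite ramanujans_periodic.
Qed.

Lemma sum_ramanujans_orthogonal p s : prime p -> all prime s -> p \notin s -> coprime p d ->
  \sum_(c < \prod_(q <- p :: s) q) ramanujans (p :: s) c = 0.
Proof.
move=> pp sp ps cp; rewrite big_cons.
rewrite (eq_bigr (fun c : 'I_(p * _) => ramanujan p c * ramanujans s c)); last first.
  by move=> c _; rewrite /ramanujans big_cons.
rewrite sum_crt ?sum_ramanujan ?mul0r ?prime_gt0 ?coprime_prod_primes //.
- exact: ramanujan_periodic.
- exact: ramanujans_periodic.
Qed.

Definition squarefree e := Defs.rad e == e.

Lemma all_coprime_primes e : coprime e d -> all (coprime^~ d) (primes e).
Proof.
move=> ced; apply/allP => p; rewrite mem_primes => /and3P[_ _ pe].
exact: coprime_dvdl ced.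
Qed.

Lemma ramanujans_corr_offdiag e e' p c0 T : squarefree e -> squarefree e' ->
  coprime e d -> p \in primes e -> p \notin primes e' ->
  `|\sum_(c < T) ramanujans (primes e) (c0 + c)%N * ramanujans (primes e') (c0 + c)%N|
     <= (e%:R * e'%:R) ^+ 2.
Proof.
move=> /eqP se /eqP se' ce pe pe'.
set s := rem p (primes e) ++ primes e'.
have pp : prime p by move: pe; rewrite mem_primes => /and3P[].
have cp : coprime p d by move/all_coprime_primes/allP: ce => /(_ _ pe).
have sp : all prime s.
  by rewrite all_cat all_prime_primes andbT; apply/allP => q /mem_rem /(allP (all_prime_primes e)).
have ps : p \notin s by rewrite mem_cat (negPf pe') orbF mem_rem_uniqF ?primes_uniq.
have E1 : (\prod_(q <- p :: s) q = e * e')%N.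
  rewrite big_cons big_cat /= mulnA -{2}se -{2}se' /Defs.rad; congr (_ * _)%N.
  by rewrite [RHS](big_rem p pe).
have E2 c : ramanujans (primes e) c * ramanujans (primes e') c = ramanujans (p :: s) c.
  by rewrite /ramanujans big_cons big_cat /= mulrA; congr (_ * _); rewrite (big_rem p pe).
under eq_bigr => c _ do rewrite E2.
have psp : all prime (p :: s) by rewrite /= pp.
have := @sum_interval_le F _ (ramanujans (p :: s)) c0 T _ 0 (prod_primes_gt0 psp)
  (ramanujans_periodic _) (lexx _) (fun c => ramanujans_norm c psp).
rewrite sum_ramanujans_orthogonal // normr0 => /(_ (lexx _)).
by rewrite mulr0 add0r E1 natrM expr2.
Qed.

Lemma ramanujans_corr e e' c0 T : squarefree e -> squarefree e' ->
  coprime e d -> coprime e' d ->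
  `|\sum_(c < T) ramanujans (primes e) (c0 + c)%N * ramanujans (primes e') (c0 + c)%N|
     <= (if e == e' then T%:R * e%:R else 0) + (e%:R * e'%:R) ^+ 2.
Proof.
move=> se se' ce ce'; case: eqP => [<-|ne].
  have sp := all_prime_primes e; have e0 := prod_primes_gt0 sp.
  have /andP[I0 I1] := sum_ramanujans_sqr sp (primes_uniq e) (all_coprime_primes ce).
  have := @sum_interval_le F _ (fun c => ramanujans (primes e) c ^+ 2) c0 T
    ((\prod_(p <- primes e) p)%:R ^+ 2) ((\prod_(p <- primes e) p)%:R ^+ 2) e0.
  rewrite (ger0_norm I0) => H; apply: le_trans (H _ _ _ _) _ => //.
  - by move=> c; rewrite ramanujans_periodic.
  - exact: sqr_ge0.
  - move=> c; rewrite normrX lerXn2r ?nnegrE //; exact: ramanujans_norm.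
  move/eqP: se e0; rewrite /Defs.rad => -> e0.
  have e1 : (1 : F) <= e%:R by rewrite ler1n.
  apply: lerD; first by rewrite expr2 mulrA mulfVK ?lt0r_neq0 // (lt_le_trans ltr01).
  rewrite exprMn; nra.
rewrite add0r.
have [/allP H1|/allPn[p pe pe']] := boolP (all [in primes e'] (primes e)); last first.
  exact: ramanujans_corr_offdiag pe pe'.
have [/allP H2|/allPn[p pe' pe]] := boolP (all [in primes e] (primes e')); last first.
  rewrite [e%:R * _]mulrC; under eq_bigr => c _ do rewrite mulrC.
  exact: ramanujans_corr_offdiag pe' pe.
case: ne; rewrite -(eqP se) -(eqP se') /Defs.rad; congr (bigop _ _ _).
apply: (irr_sorted_eq ltn_trans ltnn); rewrite ?sorted_primes // => p.
by apply/idP/idP => [/H1|/H2].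
Qed.

Definition sieve_density D : F :=
  \sum_(1 <= e < D.+1 | squarefree e && coprime e d) e%:R^-1.

(* Summing [mu(e) c_e / e] over squarefree [e <= D] gives exactly
   [sieve_density D] on the sifted set, while the [c_e] are nearly orthogonal on
   an interval; comparing the second moments gives the bound. *)
Lemma selberg_sieve (A : pred nat) c0 T D :
  (forall c, A c -> forall p, prime p -> (p <= D)%N -> ~~ (p %| (c * d).+1)%N) ->
  (\sum_(c < T) ((A (c0 + c)%N : nat)%:R : F)) * sieve_density D ^+ 2
    <= T%:R * sieve_density D + D%:R ^+ 4.
Proof.
move=> hA; set S := sieve_density D.
pose w e : F := (-1) ^+ size (primes e) / e%:R.
pose G c : F := \sum_(1 <= e < D.+1 | squarefree e && coprime e d) w e * ramanujans (primes e) c.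
have GA c : A c -> G c = S.
  move=> Ac; rewrite /G /S /sieve_density big_nat_cond [RHS]big_nat_cond.
  apply: eq_bigr => e /andP[/andP[e1 eD] _].
  have -> : ramanujans (primes e) c = (-1) ^+ size (primes e).
    rewrite /ramanujans big_seq.
    rewrite (eq_bigr (fun _ => -1)); last first.
      move=> p; rewrite mem_primes => /and3P[pp e0 pe].
      by rewrite /ramanujan (negPf (hA c Ac p pp _)) // (leq_trans (dvdn_leq e0 pe)).
    by rewrite -big_seq big_const_seq count_predT iter_mulr_1.
  by rewrite /w mulrAC -expr2 -exprM mulnC exprM sqrrN !expr1n mul1r.
have le1 : (\sum_(c < T) ((A (c0 + c)%N : nat)%:R : F)) * S ^+ 2 <= \sum_(c < T) G (c0 + c)%N ^+ 2.
  rewrite mulr_suml; apply: ler_sum => c _; case E: (A _) => /=.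
    by rewrite mul1r GA.
  by rewrite mul0r sqr_ge0.
apply: le_trans le1 _.
have -> : \sum_(c < T) G (c0 + c)%N ^+ 2 =
  \sum_(1 <= e < D.+1 | squarefree e && coprime e d)
    \sum_(1 <= e' < D.+1 | squarefree e' && coprime e' d) w e * w e' *
     \sum_(c < T) ramanujans (primes e) (c0 + c)%N * ramanujans (primes e') (c0 + c)%N.
  under eq_bigr => c _.
    rewrite expr2 /G mulr_suml.
    under eq_bigr => e _ do rewrite mulr_sumr.
  over.
  rewrite exchange_big /=; apply: eq_bigr => e _.
  rewrite exchange_big /=; apply: eq_bigr => e' _.
  by rewrite mulr_sumr; apply: eq_bigr => c _; ring.
apply: le_trans (_ : \sum_(1 <= e < D.+1 | squarefree e && coprime e d)
  (T%:R * e%:R^-1 + \sum_(1 <= e' < D.+1) e%:R * e'%:R) <= _).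
  rewrite big_nat_cond [leRHS]big_nat_cond.
  apply: ler_sum => e /andP[/andP[e1 eD] /andP[se ce]].
  apply: le_trans (_ : \sum_(1 <= e' < D.+1 | squarefree e' && coprime e' d)
    ((if e == e' then T%:R * e%:R^-1 else 0) + e%:R * e'%:R) <= _).
    rewrite big_nat_cond [leRHS]big_nat_cond.
    apply: ler_sum => e' /andP[/andP[e1' eD'] /andP[se' ce']].
    apply: le_trans (ler_norm _) _; rewrite normrM.
    have e0 : 0 < (e%:R : F) by rewrite ltr0n.
    have e0' : 0 < (e'%:R : F) by rewrite ltr0n.
    have -> : `|w e * w e'| = (e%:R * e'%:R)^-1.
      by rewrite /w !normrM !normrX normrN1 !expr1n !mul1r !ger0_norm ?invr_ge0 ?ler0n // invfM.
    apply: le_trans (ler_wpM2l _ (ramanujans_corr c0 T se se' ce ce')) _.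
      by rewrite invr_ge0 mulr_ge0 // ltW.
    rewrite mulrDr lerD //.
      case: eqP => [<-|_]; last by rewrite mulr0.
      by rewrite le_eqVlt; apply/orP; left; apply/eqP; field; rewrite lt0r_neq0.
    by rewrite le_eqVlt; apply/orP; left; apply/eqP; field; rewrite !lt0r_neq0.
  rewrite big_split /= lerD //.
    rewrite -big_mkcondr /= (big_rem e) /=; last by rewrite mem_index_iota e1.
    rewrite se ce eqxx /= big_seq_cond big1 ?addr0 // => i /andP[ir /andP[_ /eqP ei]].
    by move: ir; rewrite -ei mem_rem_uniqF // iota_uniq.
  rewrite big_mkcond /=; apply: ler_sum => e' _; case: ifP => // _.
  by rewrite mulr_ge0 ?ler0n.
rewrite big_split /= -mulr_sumr lerD2l.
apply: le_trans (_ : \sum_(1 <= e < D.+1) \sum_(1 <= e' < D.+1) D%:R * D%:R <= _).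
  rewrite big_mkcond /= big_nat [leRHS]big_nat; apply: ler_sum => e /andP[_ eD].
  case: ifP => _; last by rewrite sumr_ge0 // => i _; rewrite mulr_ge0 ?ler0n.
  rewrite big_nat [leRHS]big_nat; apply: ler_sum => e' /andP[_ eD'].
  by apply: ler_pM; rewrite ?ler0n ?ler_nat.
by rewrite !sumr_const_nat subn1 /= -[leLHS]mulr_natr -[X in X * _]mulr_natr !exprS expr0 mulr1 !mulrA.
Qed.
End Sieve.

Lemma ler_sum_surj (F : numDomainType) (I J : eqType) (r : seq I) (s : seq J)
    (P : pred I) (Q : pred J) (phi : J -> I) (a : I -> F) (b : J -> F) :
  uniq r -> (forall j, j \in s -> Q j -> 0 <= b j) ->
  (forall i, i \in r -> P i -> exists j, [/\ j \in s, Q j, phi j = i & a i <= b j]) ->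
  \sum_(i <- r | P i) a i <= \sum_(j <- s | Q j) b j.
Proof.
move=> ur b0 hs.
apply: le_trans (_ : \sum_(i <- r | P i) \sum_(j <- s | Q j && (phi j == i)) b j <= _).
  rewrite big_seq_cond [leRHS]big_seq_cond; apply: ler_sum => i /andP[ir Pi].
  have [j [js Qj ej aij]] := hs i ir Pi.
  rewrite (big_rem j) //= Qj ej eqxx /= (le_trans aij) // lerDl big_seq_cond.
  apply: sumr_ge0 => k /andP[/mem_rem ks /andP[Qk _]]; exact: b0.
rewrite (exchange_big_dep Q) //=; last by move=> i j _ /andP[].
rewrite big_seq_cond [leRHS]big_seq_cond; apply: ler_sum => j /andP[js Qj].
rewrite -big_filter big_const_seq count_predT iter_addr_0.
suff : (size [seq i <- r | P i && (Q j && (phi j == i))] <= 1)%N.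
  case: (size _) => [|[|//]] _; first by rewrite mulr0n b0.
  by rewrite mulr1n.
rewrite size_filter Qj /=; apply: leq_trans (_ : count (pred1 (phi j)) r <= 1)%N.
  by apply: sub_count => i /andP[_ /eqP <-] /=.
by rewrite count_uniq_mem // leq_b1.
Qed.

Section Harmonic.
Variable F : realFieldType.

Definition harmonic n : F := \sum_(1 <= i < n.+1) i%:R^-1.

Lemma harmonic_ge0 n : 0 <= harmonic n.
Proof. by apply: sumr_ge0 => i _; rewrite invr_ge0 ler0n. Qed.

Lemma le_harmonic m n : (m <= n)%N -> harmonic m <= harmonic n.
Proof.
move=> mn; rewrite [leRHS](@big_cat_nat _ _ _ m.+1) //= lerDl.
by apply: sumr_ge0 => i _; rewrite invr_ge0 ler0n.
Qed.

Lemma sum_dyadic (g : nat -> F) n :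
  \sum_(1 <= c < 2 ^ n) g c = \sum_(i < n) \sum_(j < 2 ^ i) g (2 ^ i + j)%N.
Proof.
elim: n => [|n IH]; first by rewrite expn0 big_geq // big_ord0.
rewrite big_ord_recr /= -IH (@big_cat_nat _ _ _ (2 ^ n)) ?expn_gt0 ?leq_exp2l //=.
congr (_ + _); rewrite -{1}[(2 ^ n)%N]add0n big_addn expnS mul2n -addnn addnK big_mkord.
by apply: eq_bigr => j _; rewrite addnC.
Qed.

Lemma harmonic_dyadic n :
  harmonic (2 ^ n) = \sum_(i < n) \sum_(j < 2 ^ i) (2 ^ i + j)%:R^-1 + (2 ^ n)%:R^-1.
Proof. by rewrite /harmonic big_nat_recr ?expn_gt0 //= (sum_dyadic (fun c => c%:R^-1)). Qed.

Lemma harmonic_pow2_ge n : 1 + n%:R / 2 <= harmonic (2 ^ n).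
Proof.
rewrite /harmonic big_ltn ?ltnS ?expn_gt0 // invr1 lerD2l.
elim: n => [|n IH]; first by rewrite mul0r big_geq.
rewrite (@big_cat_nat _ _ _ (2 ^ n).+1) ?ltnS ?expn_gt0 ?leq_exp2l //=.
rewrite -natr1 mulrDl lerD // mul1r.
apply: le_trans (_ : \sum_((2 ^ n).+1 <= i < (2 ^ n.+1).+1) (2 ^ n.+1)%:R^-1 <= _).
  rewrite sumr_const_nat subSS expnS mul2n -addnn addnK -[leRHS]mulr_natr.
  have : (0 : F) < (2 ^ n)%:R by rewrite ltr0n expn_gt0.
  rewrite natrD; move: (2 ^ n)%:R => t t0; rewrite le_eqVlt; apply/orP; left; apply/eqP.
  by field; rewrite lt0r_neq0 ?addr_gt0.
apply: ler_sum_nat => i /andP[i1 i2].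
by rewrite lef_pV2 ?posrE ?ltr0n ?expn_gt0 ?ler_nat //; lia.
Qed.

Lemma harmonic_pow2_le n : harmonic (2 ^ n) <= 1 + n%:R.
Proof.
rewrite harmonic_dyadic addrC; apply: lerD.
  by rewrite invf_le1 ?ltr0n ?expn_gt0 // ler1n expn_gt0.
apply: le_trans (_ : \sum_(i < n) 1 <= _); last by rewrite sumr_const card_ord.
apply: ler_sum => i _.
apply: le_trans (_ : \sum_(j < 2 ^ i) (2 ^ i)%:R^-1 <= _).
  by apply: ler_sum => j _; rewrite lef_pV2 ?posrE ?ltr0n ?ler_nat ?addn_gt0 ?expn_gt0 ?leq_addr.
by rewrite sumr_const card_ord -[leLHS]mulr_natr mulVf // pnatr_eq0 -lt0n expn_gt0.
Qed.

Lemma sum_inv_sqr_le a b : (0 < a)%N -> \sum_(a.+1 <= q < b) (q%:R ^+ 2)^-1 <= a%:R^-1 :> F.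
Proof.
move=> a0; case: (leqP b a.+1) => [ba|ab]; first by rewrite big_geq ?invr_ge0 ?ler0n.
apply: le_trans (_ : \sum_(a.+1 <= q < b) (- q%:R^-1 - - (q.-1)%:R^-1) <= _).
  apply: ler_sum_nat => q /andP[q1 _].
  have q0 : (0 : F) < q.-1%:R by rewrite ltr0n; lia.
  have -> : q%:R = q.-1%:R + 1 :> F by rewrite natr1 prednK //; lia.
  move: q.-1%:R q0 => t t0; rewrite -subr_ge0.
  have -> : - (t + 1)^-1 - - t^-1 - ((t + 1) ^+ 2)^-1 = (t * (t + 1) ^+ 2)^-1.
    by field; apply/andP; split; rewrite lt0r_neq0 //; lra.
  by rewrite invr_ge0 mulr_ge0 ?sqr_ge0 // ltW.
rewrite big_add1 /= telescope_sumr /=; last by lia.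
by rewrite opprK gerDr oppr_le0 invr_ge0 ler0n.
Qed.

Lemma sum_multiples_le r n (g : nat -> F) : (0 < r)%N -> (forall i, 0 <= g i) ->
  \sum_(1 <= i < n.+1 | (r %| i)%N) g i <= \sum_(1 <= j < n.+1) g (r * j)%N.
Proof.
move=> r0 g0; apply: (ler_sum_surj (phi := muln r)) => //; first exact: iota_uniq.
move=> i; rewrite mem_index_iota => /andP[i1 iN] /dvdnP[j ej].
exists j; split=> //; last by rewrite ej mulnC.
  by rewrite mem_index_iota; apply/andP; split; nia.
by rewrite mulnC.
Qed.

End Harmonic.

Lemma squarefreeP e : (0 < e)%N -> (forall p, prime p -> ~~ (p ^ 2 %| e)%N) -> squarefree e.
Proof.
move=> e0 he; rewrite /squarefree /Defs.rad {2}(prod_prime_decomp e0) prime_decompE big_map /=.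
apply/eqP; apply: eq_big_seq => p; rewrite mem_primes => /and3P[pp _ pe].
have : (0 < logn p e)%N by rewrite logn_gt0 mem_primes pp e0.
have := he p pp; rewrite pfactor_dvdn // -ltnNge.
by case: (logn p e) => [|[|]].
Qed.

Lemma squarefree_decomp n : (0 < n)%N -> exists e s, [/\ n = e * s ^ 2, squarefree e & 0 < s]%N.
Proof.
elim/ltn_ind: n => n IH n0.
have [/hasP[p]|/hasPn H] := boolP (has (fun p => (p ^ 2 %| n)%N) (primes n)).
  rewrite mem_primes => /and3P[pp _ _] /dvdnP[m em].
  have p1 := prime_gt1 pp.
  have m0 : (0 < m)%N by move: n0; rewrite em; case: m {em}.
  have [|e [s [em' se s0]]] := IH m _ m0; first by rewrite em -mulnn; nia.
  by exists e, (s * p)%N; rewrite em em' muln_gt0 s0 prime_gt0 // expnMn mulnA.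
exists n, 1%N; rewrite muln1; split=> //; apply: squarefreeP => // p pp.
apply/negP => pn; have /H : p \in primes n.
  by rewrite mem_primes pp n0 (dvdn_trans _ pn) // dvdn_exp.
by rewrite pn.
Qed.

Section BrunTitchmarsh.
Variables (F : realFieldType) (d : nat).
Hypothesis d_gt0 : (0 < d)%N.
Hypothesis small_primes : \sum_(r <- primes d) r%:R^-1 <= 2^-1 :> F.

Lemma harmonic_coprime n :
  harmonic F n <= 2 * \sum_(1 <= i < n.+1 | coprime i d) i%:R^-1.
Proof.
have H : harmonic F n <= \sum_(1 <= i < n.+1 | coprime i d) i%:R^-1 +
     \sum_(r <- primes d) \sum_(1 <= i < n.+1 | (r %| i)%N) i%:R^-1.
  under [X in _ <= _ + X]eq_bigr => r _ do rewrite big_mkcond.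
  rewrite exchange_big /= [X in _ <= X + _]big_mkcond -big_split /=.
  apply: ler_sum_nat => i /andP[i1 _].
  have i0 : 0 <= i%:R^-1 :> F by rewrite invr_ge0 ler0n.
  have S0 : 0 <= \sum_(r <- primes d) (if (r %| i)%N then i%:R^-1 else 0) :> F.
    by apply: sumr_ge0 => r _; case: ifP.
  case: ifP => [_|/negbT nc]; first by rewrite lerDl.
  have [r rd ri] : exists2 r, r \in primes d & (r %| i)%N.
    exists (pdiv (gcdn i d)); last by rewrite (dvdn_trans (pdiv_dvd _)) // dvdn_gcdl.
    rewrite mem_primes pdiv_prime ?d_gt0 ?(dvdn_trans (pdiv_dvd _)) ?dvdn_gcdr //.
    by rewrite ltn_neqAle eq_sym nc gcdn_gt0 d_gt0 orbT.
  rewrite add0r (big_rem r) //= ri lerDl; apply: sumr_ge0 => k _; by case: ifP.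
have H2 : \sum_(r <- primes d) \sum_(1 <= i < n.+1 | (r %| i)%N) i%:R^-1 <= 2^-1 * harmonic F n.
  apply: le_trans (_ : (\sum_(r <- primes d) r%:R^-1) * harmonic F n <= _); last first.
    by rewrite ler_wpM2r // harmonic_ge0.
  rewrite mulr_suml big_seq [leRHS]big_seq; apply: ler_sum => r.
  rewrite mem_primes => /and3P[pr _ _].
  apply: le_trans (sum_multiples_le _ _ _) _; rewrite ?prime_gt0 //.
    by move=> i; rewrite invr_ge0 ler0n.
  by rewrite mulr_sumr; apply: ler_sum => j _; rewrite natrM invfM.
move: H H2; set h := harmonic _ _; set u := \sum_(_ <- _) _; set v := \sum_(_ <= _ < _ | _) _.
move=> ? ?; lra.
Qed.

Lemma sieve_density_ge n : harmonic F n <= 4 * sieve_density F d n.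
Proof.
apply: le_trans (harmonic_coprime n) _.
have H : \sum_(1 <= i < n.+1 | coprime i d) i%:R^-1 <=
   \sum_(x <- [seq (e, s) | e <- [seq e <- index_iota 1 n.+1 | squarefree e && coprime e d], s <- index_iota 1 n.+1]) x.1%:R^-1 * (x.2%:R ^+ 2)^-1 :> F.
  apply: (ler_sum_surj (phi := fun x => (x.1 * x.2 ^ 2)%N)) => //; first exact: iota_uniq.
    by move=> x _ _; rewrite mulr_ge0 ?invr_ge0 ?sqr_ge0 ?ler0n.
  move=> i; rewrite mem_index_iota => /andP[i1 iN] ci.
  have [e [s [ei se s0]]] := squarefree_decomp i1.
  have e0 : (0 < e)%N by move: i1; rewrite ei; case: e {ei se}.
  exists (e, s); split=> //=; last by rewrite ei natrM natrX invfM.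
  apply: allpairs_f; rewrite ?mem_filter ?mem_index_iota.
    rewrite se (coprime_dvdl _ ci) ?e0 /=; last by rewrite ei dvdn_mulr.
    by apply: leq_ltn_trans iN; rewrite ei leq_pmulr // expn_gt0 s0.
  rewrite s0 /=; apply: leq_ltn_trans iN; rewrite ei.
  by apply: leq_trans (_ : s ^ 2 <= _)%N; rewrite ?leq_pmull // -mulnn leq_pmulr.
rewrite big_allpairs big_filter /= in H.
have S2 : \sum_(1 <= s < n.+1) (s%:R ^+ 2)^-1 <= 2 :> F.
  case: n => [|n] in H *; first by rewrite big_geq.
  by rewrite big_ltn // expr1n invr1 (natrD _ 1 1) lerD2l (le_trans (sum_inv_sqr_le _ _ _)) ?invr1.
have H' : \sum_(1 <= i < n.+1 | coprime i d) i%:R^-1 <= sieve_density F d n * 2.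
  apply: le_trans H _; rewrite /sieve_density mulr_suml; apply: ler_sum => e _.
  by rewrite -mulr_sumr ler_wpM2l // invr_ge0 ler0n.
apply: le_trans (ler_wpM2l _ H') _; rewrite ?ler0n // mulrCA mulrC.
by rewrite -(natrM _ 2 2).
Qed.

Lemma count_primes_progression i :
  \sum_(j < 2 ^ i) ((prime ((2 ^ i + j) * d).+1 : nat)%:R) <= 64 * 2 ^+ i / i.+1%:R :> F.
Proof.
set D := (2 ^ (i %/ 4))%N; set S := sieve_density F d D.
have /= := @selberg_sieve F d (fun c => (2 ^ i <= c)%N && prime (c * d).+1) (2 ^ i) (2 ^ i) D _.
rewrite -/S => H.
have {H} : (\sum_(j < 2 ^ i) ((prime ((2 ^ i + j) * d).+1 : nat)%:R)) * S ^+ 2 <= (2 ^ i)%:R * S + D%:R ^+ 4 :> F.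
  apply: le_trans (H _); first by rewrite le_eqVlt; apply/orP; left; apply/eqP; congr (_ * _); apply: eq_bigr => j _; rewrite leq_addr.
  move=> c /andP[c1 pc] p pp pD; apply/negP; rewrite dvdn_prime2 // => /eqP ep.
  have : (c < p)%N by rewrite ep ltnS leq_pmulr.
  have : (D <= 2 ^ i)%N by rewrite leq_exp2l // leq_div.
  lia.
have DT : D%:R ^+ 4 <= (2 ^ i)%:R :> F.
  by rewrite -natrX ler_nat -expnM leq_exp2l // leq_divM.
have S1 : 1 <= S.
  rewrite /S /sieve_density big_mkcond big_ltn ?ltnS ?expn_gt0 //= coprime1n.
  rewrite /squarefree /Defs.rad big_nil eqxx /= invr1 lerDl; apply: sumr_ge0 => e _.
  by case: ifP; rewrite ?invr_ge0 ?ler0n.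
have Si : i.+1%:R <= 32 * S.
  have : harmonic F D <= 4 * S by exact: sieve_density_ge.
  have := harmonic_pow2_ge F (i %/ 4); rewrite -/D.
  have : (i.+1 <= 4 + 4 * (i %/ 4))%N by lia.
  rewrite -(ler_nat F) natrD natrM; move: {S1}S (harmonic _ _) (i %/ 4)%:R i.+1%:R => *; lra.
set N := \sum_(_ < _) _; have N0 : 0 <= N by apply: sumr_ge0 => j _; rewrite ler0n.
rewrite natrX in DT *; have T0 : 0 <= 2 ^+ i :> F by rewrite exprn_ge0.
move: (2 ^+ i : F) T0 DT => T T0 DT H.
have i0 : (0 : F) < i.+1%:R by rewrite ltr0n.
rewrite ler_pdivlMr //.
have : N * S <= 2 * T.
  have S0 : 0 < S by lra.
  rewrite -(ler_pM2r S0) -[N * S * S]mulrA -expr2 -mulrA mulr_natl mulr2n.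
  by apply: le_trans H _; rewrite lerD2l (le_trans DT) // ler_peMr // T0.
move=> NS; apply: le_trans (ler_wpM2l N0 Si) _.
by rewrite mulrCA (_ : 64 = 32 * 2) -?mulrA ?ler_wpM2l ?ler0n // -natrM.
Qed.

Lemma sum_inv_primes_progression n :
  \sum_(0 <= p < (2 ^ n).+1 | prime p && (d %| p.-1)%N) p%:R^-1 <= 64 * harmonic F n / d%:R.
Proof.
have d0 : (0 : F) < d%:R by rewrite ltr0n.
apply: le_trans (_ : \sum_(1 <= c < 2 ^ n) (prime (c * d).+1 : nat)%:R * (c * d)%:R^-1 <= _).
  apply: (ler_sum_surj (phi := fun c => (c * d).+1)) => //; first exact: iota_uniq.
    by move=> j _ _; rewrite mulr_ge0 ?invr_ge0 ?ler0n.
  move=> p; rewrite mem_index_iota => /andP[_ pN] /andP[pp /dvdnP[c ec]].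
  have p1 := prime_gt1 pp.
  have ep : (c * d).+1 = p by lia.
  exists c; rewrite ep pp; split=> //; first by rewrite mem_index_iota; nia.
  by rewrite mul1r -ec lef_pV2 ?posrE ?ltr0n ?ler_nat; lia.
rewrite sum_dyadic /harmonic big_add1 /= big_mkord mulr_sumr mulr_suml.
apply: ler_sum => i _.
apply: le_trans (_ : (\sum_(j < 2 ^ i) ((prime ((2 ^ i + j) * d).+1 : nat)%:R)) * (2 ^+ i * d%:R)^-1 <= _).
  rewrite mulr_suml; apply: ler_sum => j _; rewrite ler_wpM2l ?ler0n //.
  rewrite lef_pV2 ?posrE -?natrX -?natrM ?ltr0n ?ler_nat ?muln_gt0 ?addn_gt0 ?expn_gt0 ?d_gt0 //.
  by rewrite leq_mul2r leq_addr orbT.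
have t0 : (0 : F) < 2 ^+ i by rewrite exprn_gt0.
apply: le_trans (ler_wpM2r _ (count_primes_progression i)) _; first by rewrite invr_ge0 mulr_ge0 // ltW.
have u0 : (0 : F) < i.+1%:R by rewrite ltr0n.
move: (2 ^+ i : F) i.+1%:R t0 u0 => t u t0 u0; rewrite le_eqVlt; apply/orP; left; apply/eqP.
by field; rewrite !lt0r_neq0.
Qed.
End BrunTitchmarsh.

(** * Logarithms of natural numbers *)

Lemma succ_div_subr1_le (F : realFieldType) (t : F) : 1 <= t -> (t + 1) / t - 1 <= 2 / (t + 1).
Proof.
move=> t1; have t0 : 0 < t := lt_le_trans ltr01 t1.
rewrite -subr_ge0 (_ : _ - _ = (t - 1) / (t * (t + 1)) :> F).
  by rewrite divr_ge0 ?mulr_ge0 ?subr_ge0 ?addr_ge0 // ltW.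
by field; rewrite !lt0r_neq0 // addr_gt0.
Qed.

Section LogNat.

Definition lg (n : nat) : R := ln n%:R.
Arguments lg n%_nat.

Lemma lgM (m n : nat) : (0 < m)%N -> (0 < n)%N -> lg (m * n) = lg m + lg n.
Proof. by move=> m0 n0; rewrite /lg natrM; apply: ln_mult; apply/RltP; rewrite ltr0n. Qed.

Lemma lg1 : lg 1 = 0. Proof. exact: ln_1. Qed.

Lemma le_lg (m n : nat) : (0 < m)%N -> (m <= n)%N -> lg m <= lg n.
Proof.
move=> m0; rewrite leq_eqVlt => /orP[/eqP-> //|mn].
by apply/ltW/RltP/ln_increasing; apply/RltP; rewrite ?ltr0n ?ltr_nat.
Qed.

Lemma lg0 : lg 0 = 0.
Proof. by rewrite /lg /ln; case: Rlt_dec => // H; have := Rlt_irrefl _ H. Qed.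

Lemma lg_ge0 n : 0 <= lg n.
Proof. by case: n => [|n]; [rewrite lg0 | rewrite -lg1 le_lg]. Qed.

Lemma ln_le_subr1 (x : R) : 0 < x -> ln x <= x - 1.
Proof.
move=> x0; have := exp_ineq1_le (ln x); rewrite exp_ln; last by apply/RltP.
by move=> /RleP; rewrite RplusE R1E => ?; lra.
Qed.

Lemma lg_pred_ge p : (1 < p)%N -> lg p - lg p.-1 <= 2 / p%:R.
Proof.
move=> p1; have q0 : 0 < p.-1%:R :> R by rewrite ltr0n; lia.
have p0 : 0 < p%:R :> R by rewrite ltr0n; lia.
have -> : lg p - lg p.-1 = ln (p%:R / p.-1%:R)%R.
  rewrite /lg ln_mult ?ln_Rinv //; try (apply/RltP); rewrite ?invr_gt0 //.
apply: le_trans (ln_le_subr1 _) _; first by rewrite divr_gt0.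
have -> : p%:R = p.-1%:R + 1 :> R by rewrite natr1 prednK //; lia.
by apply: succ_div_subr1_le; rewrite ler1n; lia.
Qed.

Lemma lgX (m n : nat) : (0 < m)%N -> lg (m ^ n) = n%:R * lg m.
Proof.
move=> m0; elim: n => [|n IH]; first by rewrite expn0 lg1 mul0r.
by rewrite expnS lgM ?expn_gt0 ?m0 // IH -nat1r mulrDl mul1r.
Qed.

Lemma lg2_le1 : lg 2 <= 1.
Proof.
apply: le_trans (ln_le_subr1 _) _; rewrite ?ltr0n //; lra.
Qed.

Lemma lg_prod (r : seq nat) (P : pred nat) : (forall q, q \in r -> P q -> 0 < q)%N ->
  lg (\prod_(q <- r | P q) q) = \sum_(q <- r | P q) lg q.
Proof.
elim: r => [|q r IH] H; first by rewrite !big_nil lg1.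
have IH' := IH (fun t tr => H t (mem_behead (s := q :: r) tr)).
rewrite !big_cons; case: ifP => // Pq; rewrite -IH' lgM //; first exact: H (mem_head _ _) Pq.
rewrite big_seq_cond; apply: prodn_cond_gt0 => t /andP[tr Pt].
by apply: H => //; rewrite inE tr orbT.
Qed.

Lemma lg_von_mangoldt X n : (0 < n)%N -> (n <= 2 ^ X)%N ->
  lg n = \sum_(0 <= q < (2 ^ X).+1 | prime q) \sum_(1 <= a < X.+1) ((q ^ a %| n)%N : nat)%:R * lg q.
Proof.
move=> n0 nX.
have -> : lg n = \sum_(0 <= q < (2 ^ X).+1 | prime q) (logn q n)%:R * lg q.
  have -> : lg n = \sum_(q <- primes n) (logn q n)%:R * lg q.
    rewrite {1}(prod_prime_decomp n0) prime_decompE big_map /=.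
    have : all prime (primes n) by exact: all_prime_primes.
    elim: (primes n) => [|q r IH] /=; first by rewrite !big_nil lg1.
    move=> /andP[pq pr]; rewrite !big_cons lgM.
    - by rewrite IH // lgX ?prime_gt0.
    - by rewrite expn_gt0 prime_gt0.
    rewrite big_seq; apply: prodn_cond_gt0 => t tr; rewrite expn_gt0 prime_gt0 //.
    exact: (allP pr).
  rewrite [RHS](bigID [in primes n]) /= [X in _ + X]big1 ?addr0; last first.
    move=> q /andP[_ nq]; rewrite (_ : logn q n = 0)%N ?mul0r //.
    by apply/eqP; rewrite -leqn0 leqNgt logn_gt0.
  rewrite -[RHS]big_filter; apply: perm_big; apply: uniq_perm.
  - exact: primes_uniq.
  - by rewrite !filter_uniq ?iota_uniq.
  move=> q; rewrite !mem_filter mem_index_iota mem_primes n0 /=.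
  case pq: (prime q) => //=; case qn: (q %| n)%N => //=.
  by rewrite ltnS (leq_trans (dvdn_leq n0 qn)).
apply: eq_bigr => q pq; rewrite -mulr_suml; congr (_ * _).
rewrite -natr_sum; congr (_%:R).
have lX : (logn q n <= X)%N.
  rewrite -(leq_exp2l _ _ (prime_gt1 pq)); apply: leq_trans (_ : 2 ^ X <= _)%N.
    by apply: leq_trans nX; rewrite dvdn_leq // pfactor_dvdnn.
  by case: (X) => [|e]; rewrite ?expn0 // leq_exp2r // prime_gt1.
under eq_big_nat => a _ do rewrite pfactor_dvdn //.
rewrite (@big_cat_nat _ _ _ (logn q n).+1) //= [X in (_ + X)%N]big1_seq; last first.
  by move=> a; rewrite mem_index_iota => /andP[_ /andP[a1 _]]; rewrite leqNgt a1.
rewrite addn0 big_nat (eq_bigr (fun _ => 1%N)); last by move=> a /andP[_]; rewrite ltnS => ->.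
by rewrite -big_nat sum_nat_const_nat muln1 subn1.
Qed.
End LogNat.

(** * The tree of prime divisors of shifted primes *)

Lemma sum_pairs_idempotent (F : comPzRingType) (I : eqType) (r : seq I) (b : I -> F) :
  uniq r -> (forall i, b i * b i = b i) ->
  \sum_(i <- r) \sum_(j <- r | i != j) b i * b j = (\sum_(i <- r) b i) ^+ 2 - \sum_(i <- r) b i.
Proof.
move=> ur bb; rewrite expr2 [in RHS]mulr_suml -sumrB big_seq [RHS]big_seq.
apply: eq_bigr => i ir; rewrite mulr_sumr [in RHS](bigD1_seq i) //= bb addrAC subrr add0r.
by apply: eq_bigl => j; rewrite eq_sym.
Qed.

Section Descent.
Variables X z : nat.
Hypothesis X_gt0 : (0 < X)%N.
Hypothesis z_ge4 : (4 <= z)%N.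

(* The parameters are the [X] and [z] of the introduction.  The children of a
   starting value [n] are its own prime divisors, so [n] is represented by the
   node [n.+1], whether or not that is prime. *)
Definition nums := index_iota 0 (2 ^ X).+1.
Definition child (p q : nat) := [&& prime q, (z < q)%N & (q %| p.-1)%N].
Definition descend (G : nat -> R) (p : nat) : R := \sum_(q <- nums | child p q) G q.
Definition avg (G : nat -> R) : R := \sum_(p <- nums | prime p) G p / p%:R.
Definition bt_const := 64 * harmonic R X.

Lemma mem_nums q : (q \in nums) = (q <= 2 ^ X)%N.
Proof. by rewrite mem_index_iota. Qed.

Lemma bt_const_ge1 : 1 <= bt_const.
Proof.
have : 1 <= harmonic R X.
  by apply: le_trans (le_harmonic R X_gt0); rewrite /harmonic big_nat1 invr1.
by rewrite /bt_const; move: (harmonic R X) => h ?; lra.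
Qed.

Lemma sum_progression_prime_power q a : prime q -> (0 < a)%N ->
  \sum_(p <- nums | prime p && (q ^ a %| p.-1)%N) p%:R^-1 <= bt_const / (q ^ a)%:R :> R.
Proof.
move=> pq a0; apply: sum_inv_primes_progression; first by rewrite expn_gt0 prime_gt0.
rewrite primesX // primes_prime // big_seq1 lef_pV2 ?posrE ?ltr0n ?ler_nat ?prime_gt0 //.
exact: prime_gt1.
Qed.

Lemma sum_progression_two_primes r s : prime r -> prime s -> (z < r)%N -> (z < s)%N -> r != s ->
  \sum_(p <- nums | prime p && (r * s %| p.-1)%N) p%:R^-1 <= bt_const / (r * s)%:R :> R.
Proof.
move=> pr ps zr zs rs; have r0 := prime_gt0 pr; have s0 := prime_gt0 ps.
apply: sum_inv_primes_progression; first by rewrite muln_gt0 r0.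
rewrite (perm_big [:: r; s]) /=; last first.
  apply: uniq_perm; rewrite ?primes_uniq //=; first by rewrite inE rs.
  by move=> t; rewrite primesM // !primes_prime // !inE.
rewrite big_cons big_seq1.
have H t : (z < t)%N -> t%:R^-1 <= 4^-1 :> R.
  by move=> zt; rewrite lef_pV2 ?posrE ?ltr0n ?ler_nat; lia.
have := lerD (H r zr) (H s zs); move: (r%:R^-1 + s%:R^-1) => u; lra.
Qed.

Lemma descend_ge0 G p : (forall q, 0 <= G q) -> 0 <= descend G p.
Proof. by move=> G0; apply: sumr_ge0. Qed.

Lemma avg_ge0 G : (forall q, 0 <= G q) -> 0 <= avg G.
Proof. by move=> G0; apply: sumr_ge0 => p _; rewrite divr_ge0. Qed.

Lemma avgD G H : avg (fun p => G p + H p) = avg G + avg H.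
Proof. by rewrite /avg -big_split; apply: eq_bigr => p _; rewrite mulrDl. Qed.

Lemma avgZ c G : avg (fun p => c * G p) = c * avg G.
Proof. by rewrite /avg mulr_sumr; apply: eq_bigr => p _; rewrite mulrA. Qed.

Lemma avg_le G H : (forall p, (p <= 2 ^ X)%N -> prime p -> G p <= H p) -> avg G <= avg H.
Proof.
move=> GH; rewrite /avg big_seq_cond [leRHS]big_seq_cond.
by apply: ler_sum => p /andP[pX pp]; rewrite ler_wpM2r ?invr_ge0 // GH // -mem_nums.
Qed.

Fixpoint reach k p q := if k is k'.+1
  then (p == q) || has (fun r => child p r && reach k' r q) nums else false.

Definition reach_proper k p q := has (fun r => child p r && reach k r q) nums.

Lemma reachS k p q : reach k.+1 p q = (p == q) || reach_proper k p q.
Proof. by []. Qed.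

Lemma reach_prime k p q : prime p -> (z < p)%N -> reach k p q -> [/\ prime q, (z < q)%N & (q <= p)%N].
Proof.
elim: k p => [//|k IH] p pp zp /orP[/eqP<- //|/hasP[r _ /andP[/and3P[pr zr rp] H]]].
have [pq zq qr] := IH r pr zr H; split=> //; apply: leq_trans qr _.
by apply: leq_trans (leq_pred p); rewrite dvdn_leq //; have := prime_gt1 pp; lia.
Qed.

Lemma reach_proper_prime k p q : (1 < p)%N -> reach_proper k p q ->
  [/\ prime q, (z < q)%N & (q < p)%N].
Proof.
move=> p1 /hasP[r _ /andP[/and3P[pr zr rp] H]].
have [pq zq qr] := reach_prime pr zr H; split=> //; apply: leq_ltn_trans qr _.
have := dvdn_leq _ rp; lia.
Qed.

Lemma reach_parent k r q : reach k r q -> r = q \/ exists p, reach k r p /\ child p q.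
Proof.
elim: k r => [//|k IH] r /orP[/eqP|/hasP[s sX /andP[rs H]]]; first by left.
case: (IH s H) => [<-|[p [sp pq]]]; right; first by exists r; rewrite /= eqxx.
by exists p; split=> //; apply/orP; right; apply/hasP; exists s; rewrite ?rs.
Qed.

(* [height k p] is the logarithm of the product of the distinct primes reached
   from [p] in fewer than [k] steps; it would be [k%:R * lg p] without losses. *)
Definition height k p : R := \sum_(q <- nums | reach k p q) lg q.
Definition height_proper k p : R := \sum_(q <- nums | reach_proper k p q) lg q.
Definition overlap k p : R := \sum_(r <- nums | child p r) \sum_(s <- nums | child p s && (r != s))
  \sum_(q <- nums | reach k r q && reach k s q) lg q.

Lemma height_properE k p : height_proper k p = \sum_(q <- nums) (reach_proper k p q : nat)%:R * lg q.
Proof.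
rewrite /height_proper big_mkcond; apply: eq_bigr => q _.
by case: ifP; rewrite ?mul1r ?mul0r.
Qed.

Lemma descend_heightE k p : descend (height k) p =
  \sum_(q <- nums) (\sum_(r <- nums) (child p r && reach k r q : nat)%:R) * lg q.
Proof.
rewrite /descend /height; under [RHS]eq_bigr => q _ do rewrite mulr_suml.
rewrite exchange_big /= big_mkcond; apply: eq_bigr => r _.
case: (child p r) => /=; last by rewrite big1 // => q _; rewrite mul0r.
by rewrite big_mkcond; apply: eq_bigr => q _; case: ifP; rewrite ?mul1r ?mul0r.
Qed.

Lemma overlapE k p : overlap k p =
  \sum_(q <- nums) (\sum_(r <- nums) \sum_(s <- nums | r != s)
    (child p r && reach k r q : nat)%:R * (child p s && reach k s q : nat)%:R) * lg q.
Proof.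
rewrite /overlap.
under [RHS]eq_bigr => q _.
  rewrite mulr_suml; under eq_bigr => r _ do rewrite mulr_suml.
over.
rewrite exchange_big /= big_mkcond; apply: eq_bigr => r _.
rewrite exchange_big /=; case: (child p r) => /=; last first.
  by rewrite big1 // => s _; rewrite big1 // => q _; rewrite !mul0r.
rewrite big_mkcond [RHS]big_mkcond; apply: eq_bigr => s _.
case: (child p s) => /=; last by case: ifP => // _; rewrite big1 // => q _; rewrite mulr0 mul0r.
case: ifP => // _; rewrite big_mkcond; apply: eq_bigr => q _.
by do 2 case: (reach _ _ _); rewrite ?(mul1r, mul0r).
Qed.

(* For each [q] put [t] for the number of children of [p] reaching [q]; the
   pairs counted by [overlap] are [t ^ 2 - t], and [t - (t ^ 2 - t) <= 1]. *)
Lemma height_proper_ge k p : descend (height k) p - overlap k p <= height_proper k p.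
Proof.
rewrite height_properE descend_heightE overlapE -sumrB; apply: ler_sum => q _.
rewrite -mulrBl ler_wpM2r ?lg_ge0 //.
set b := fun r => (child p r && reach k r q : nat)%:R : R.
have bb r : b r * b r = b r by rewrite /b; case: (_ && _); rewrite ?mulr1 ?mulr0.
rewrite (sum_pairs_idempotent (iota_uniq _ _) bb).
case E: (reach_proper k p q).
  move: (\sum_(_ <- _) _) => t /=; rewrite -subr_ge0 (_ : _ - _ = (t - 1) ^+ 2) ?sqr_ge0 //; ring.
rewrite big_seq big1 ?expr0n ?subrr // => r rX; rewrite /b.
by move/hasPn: E => /(_ r rX) /negPf ->.
Qed.

Lemma height_proper_le k p : height_proper k p <= descend (height k) p.
Proof.
rewrite height_properE descend_heightE; apply: ler_sum => q _.
rewrite ler_wpM2r ?lg_ge0 //; case E: (reach_proper k p q); last by rewrite sumr_ge0.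
move/hasP: E => [r rX H]; rewrite (big_rem r) //= H lerDl; exact: sumr_ge0.
Qed.

Lemma height_succ k p : prime p -> (p <= 2 ^ X)%N -> height k.+1 p = lg p + height_proper k p.
Proof.
move=> pp pX; rewrite /height big_mkcond (bigD1_seq p) ?iota_uniq ?mem_nums ?reachS ?eqxx //=; congr (_ + _).
rewrite -big_mkcondr.
apply: eq_bigl => q; rewrite [q == p]eq_sym; case: eqP => [<-|_] //=; apply/esym/negP => /(reach_proper_prime (prime_gt1 pp))[_ _].
by rewrite ltnn.
Qed.

(* The logarithm of the part of [n] lost when only its prime divisors [> z] are
   kept, each with multiplicity one. *)
Definition waste (n : nat) : R := \sum_(q <- nums | prime q)
  \sum_(1 <= a < X.+1 | (q <= z)%N || (1 < a)%N) ((q ^ a %| n)%N : nat)%:R * lg q.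

Lemma waste_ge0 n : 0 <= waste n.
Proof. by apply: sumr_ge0 => q _; apply: sumr_ge0 => a _; rewrite mulr_ge0 ?lg_ge0. Qed.

Lemma descend_lg p : (1 < p)%N -> (p <= (2 ^ X).+1)%N -> descend lg p = lg p.-1 - waste p.-1.
Proof.
move=> p1 pX; rewrite (@lg_von_mangoldt X p.-1); [|lia|lia].
rewrite -sumrB /descend big_mkcond [RHS]big_mkcond; apply: eq_bigr => q _.
rewrite /child; case: (prime q) => //=.
rewrite [X in X - _](bigID (fun a => (q <= z)%N || (1 < a)%N)) /= addrAC subrr add0r.
rewrite ltnNge; case: (q <= z)%N => /=; first by rewrite big_pred0.
rewrite big_mkcond big_ltn //= expn1 big_nat big1 ?addr0.
  by case: (q %| _)%N; rewrite ?mul1r ?mul0r.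
by move=> a /andP[a1 _]; rewrite a1.
Qed.

(* A majorant of [k%:R * lg p - height k p]. *)
Fixpoint deficit k p : R := if k is k'.+1 then
  (descend (deficit k') p + (k'%:R * (waste p.-1 + (lg p - lg p.-1)) + overlap k' p))%R else 0%R.

Lemma descend_le G H p : (forall q, child p q -> (q <= 2 ^ X)%N -> G q <= H q) ->
  descend G p <= descend H p.
Proof.
move=> GH; rewrite /descend big_seq_cond [leRHS]big_seq_cond.
by apply: ler_sum => q /andP[qX pq]; rewrite GH // -mem_nums.
Qed.

Lemma descendD G H p : descend (fun q => G q + H q) p = descend G p + descend H p.
Proof. by rewrite /descend big_split. Qed.

Lemma descendZ c G p : descend (fun q => c * G q) p = c * descend G p.
Proof. by rewrite /descend mulr_sumr. Qed.

Lemma height_ge k p : prime p -> (p <= 2 ^ X)%N -> k%:R * lg p - deficit k p <= height k p.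
Proof.
elim: k p => [|k IH] p pp pX.
  by rewrite mul0r subr0 /height big_pred0.
rewrite height_succ //; apply: le_trans (lerD (lexx _) (height_proper_ge k p)).
have : descend (fun q => k%:R * lg q) p <= descend (height k) p + descend (deficit k) p.
  rewrite -descendD; apply: descend_le => q /and3P[pq _ _] qX.
  by rewrite -lerBlDr IH.
rewrite descendZ descend_lg ?prime_gt1 //; last by lia.
rewrite /= -natr1.
move: (descend _ _) (descend _ _) (overlap _ _) (waste _) (lg p.-1) (lg p) k%:R => a b c d e f g ?; nra.
Qed.

Lemma height_proper_root_ge k n : (0 < n)%N -> (n <= 2 ^ X)%N ->
  k%:R * lg n - (k%:R * waste n + descend (deficit k) n.+1 + overlap k n.+1) <= height_proper k n.+1.
Proof.
move=> n0 nX; apply: le_trans (height_proper_ge k n.+1).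
have : descend (fun q => k%:R * lg q) n.+1 <= descend (height k) n.+1 + descend (deficit k) n.+1.
  rewrite -descendD; apply: descend_le => q /and3P[pq _ _] qX.
  by rewrite -lerBlDr height_ge.
rewrite descendZ descend_lg //=.
move: (descend _ _) (descend _ _) (overlap _ _) (waste _) (lg n) k%:R => a b c d e g ?; lra.
Qed.

Lemma height_le k p : prime p -> (p <= 2 ^ X)%N -> height k p <= k%:R * lg p.
Proof.
elim: k p => [|k IH] p pp pX; first by rewrite mul0r /height big_pred0.
rewrite height_succ // -nat1r mulrDl mul1r lerD2l.
apply: le_trans (height_proper_le k p) _.
apply: le_trans (_ : descend (fun q => k%:R * lg q) p <= _).
  by apply: descend_le => q /and3P[pq _ _] qX; apply: IH.
have p1 := prime_gt1 pp; rewrite descendZ descend_lg ?ler_wpM2l //; last by lia.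
by rewrite lerBlDr (le_trans (le_lg _ (leq_pred p))) ?lerDl ?waste_ge0 //; lia.
Qed.

Lemma height_proper_root_le k n : (0 < n)%N -> (n <= 2 ^ X)%N -> height_proper k n.+1 <= k%:R * lg n.
Proof.
move=> n0 nX; apply: le_trans (height_proper_le k _) _.
apply: le_trans (_ : descend (fun q => k%:R * lg q) n.+1 <= _).
  by apply: descend_le => q /and3P[pq _ _] qX; apply: height_le.
by rewrite descendZ descend_lg // ler_wpM2l //= lerBlDr lerDl waste_ge0.
Qed.

(* Both the primes [p <= 2 ^ X] weighted by [1 / p] and the starting values [n]
   satisfy this divisibility estimate, so averages over them are handled alike. *)
Definition spread (ps : seq nat) (w : nat -> R) (c : R) : Prop :=
  [/\ 0 <= c, forall p, 0 <= w p,
      forall q a, prime q -> (0 < a)%N ->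
        \sum_(p <- ps | (q ^ a %| p.-1)%N) w p <= c / (q ^ a)%:R
    & forall r s, prime r -> prime s -> (z < r)%N -> (z < s)%N -> r != s ->
        \sum_(p <- ps | (r * s %| p.-1)%N) w p <= c / (r * s)%:R].

Definition prime_nums := [seq p <- nums | prime p].

Lemma spread_primes : spread prime_nums (fun p => p%:R^-1) bt_const.
Proof.
split=> [|p|q a pq a0|r s pr ps zr zs rs].
- exact: le_trans ler01 bt_const_ge1.
- by rewrite invr_ge0.
- rewrite big_filter_cond; exact: sum_progression_prime_power.
- rewrite big_filter_cond; exact: sum_progression_two_primes.
Qed.

Lemma avgE G : avg G = \sum_(p <- prime_nums) p%:R^-1 * G p.
Proof. by rewrite /avg big_filter; apply: eq_bigr => p _; rewrite mulrC. Qed.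

Definition roots := [seq n.+1 | n <- index_iota 1 (2 ^ X).+1].

Lemma spread_roots : spread roots (fun _ => 1) (2 ^ X)%:R.
Proof.
have H d : (0 < d)%N -> \sum_(p <- roots | (d %| p.-1)%N) 1 <= (2 ^ X)%:R / d%:R :> R.
  move=> d0; rewrite big_map /= big_const_seq iter_addr_0 ler_pdivlMr ?ltr0n //.
  rewrite -natrM ler_nat -sum1_count big_mkcond /= -divn_count_dvd; exact: leq_divM.
split=> // [q a pq a0|r s pr ps _ _ _]; apply: H.
  by rewrite expn_gt0 prime_gt0.
by rewrite muln_gt0 !prime_gt0.
Qed.

Definition waste_bound := \sum_(q <- nums | prime q)
  \sum_(1 <= a < X.+1 | (q <= z)%N || (1 < a)%N) lg q / (q ^ a)%:R.

Section Spread.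
Variables (ps : seq nat) (w : nat -> R) (c : R).
Hypothesis hs : spread ps w c.

Lemma spread_descend G : (forall q, 0 <= G q) ->
  \sum_(p <- ps) w p * descend G p <= c * avg G.
Proof.
case: hs => _ w0 h1 _ G0; rewrite /avg /descend.
under eq_bigr => p _ do rewrite mulr_sumr.
rewrite (exchange_big_dep prime) /=; last by move=> p q _ /and3P[].
rewrite mulr_sumr; apply: ler_sum => q pq.
apply: le_trans (_ : \sum_(p <- ps | (q %| p.-1)%N) w p * G q <= _).
  rewrite big_mkcond [leRHS]big_mkcond; apply: ler_sum => p _.
  rewrite /child pq /=; case: (q %| _)%N; rewrite ?andbF //= andbT.
  by case: ifP => // _; rewrite mulr_ge0.
rewrite -mulr_suml mulrC mulrCA ler_wpM2l //.
by have := h1 q 1 pq isT; rewrite !expn1.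
Qed.

Lemma spread_waste : \sum_(p <- ps) w p * waste p.-1 <= c * waste_bound.
Proof.
case: hs => _ w0 h1 _; rewrite /waste /waste_bound.
under eq_bigr => p _.
  rewrite mulr_sumr; under eq_bigr => q _ do rewrite mulr_sumr.
over.
rewrite exchange_big mulr_sumr; apply: ler_sum => q pq.
rewrite exchange_big mulr_sumr big_nat_cond [leRHS]big_nat_cond.
apply: ler_sum => a /andP[/andP[a0 _] _].
apply: le_trans (_ : (\sum_(p <- ps | (q ^ a %| p.-1)%N) w p) * lg q <= _).
  rewrite mulr_suml [leRHS]big_mkcond; apply: ler_sum => p _.
  by case: (_ %| _)%N; rewrite ?mul1r // mul0r mulr0.
by rewrite mulrCA mulrC ler_wpM2l ?lg_ge0 // h1.
Qed.

Lemma spread_overlap k : \sum_(p <- ps) w p * overlap k p <=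
  c * (X%:R * \sum_(q <- nums | prime q && (z < q)%N) avg (fun p => (reach k p q : nat)%:R) ^+ 2).
Proof.
case: hs => c0 w0 _ h2.
pose big q := prime q && (z < q)%N.
pose Z r s : R := \sum_(q <- nums | reach k r q && reach k s q) lg q.
have Z0 r s : 0 <= Z r s by apply: sumr_ge0 => q _; exact: lg_ge0.
apply: le_trans (_ : \sum_(r <- nums | big r) \sum_(s <- nums | big s && (r != s))
   Z r s * (c / (r * s)%:R) <= _).
  under eq_bigr => p _.
    rewrite mulr_sumr; under eq_bigr => r _ do rewrite mulr_sumr.
  over.
  rewrite (exchange_big_dep big) /=; last by move=> p r _ /and3P[pr zr _]; apply/andP.
  apply: ler_sum => r /andP[pr zr].
  rewrite (exchange_big_dep (fun s => big s && (r != s))) /=; last first.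
    by move=> p s _ /andP[/and3P[ps' zs _] rs]; rewrite /big ps' zs.
  apply: ler_sum => s /andP[/andP[ps' zs] rs].
  apply: le_trans (ler_wpM2l (Z0 r s) (h2 r s pr ps' zr zs rs)).
  rewrite mulr_sumr big_mkcond [leRHS]big_mkcond; apply: ler_sum => p _.
  rewrite /child pr zr ps' zs rs /= andbT Gauss_dvd; last by rewrite prime_coprime // dvdn_prime2.
  by case: (_ && _) => //; rewrite mulrC.
apply: le_trans (_ : \sum_(r <- nums | big r) \sum_(s <- nums | big s && (r != s))
  \sum_(q <- nums | big q) c * (X%:R * (((reach k r q : nat)%:R / r%:R) * ((reach k s q : nat)%:R / s%:R))) <= _).
  apply: ler_sum => r /andP[pr zr]; apply: ler_sum => s /andP[/andP[ps' zs] rs].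
  rewrite /Z mulr_suml big_seq_cond [leRHS]big_mkcond [leRHS]big_seq.
  rewrite big_mkcondr /=; apply: ler_sum => q qX.
  case: ifP => [/andP[rq sq]|_]; last first.
    by case: ifP => // _; rewrite !mulr_ge0 ?invr_ge0.
  have [pq zq _] := reach_prime pr zr rq.
  rewrite /big pq zq rq sq /= !mul1r natrM invfM mulrCA ler_wpM2l //.
  rewrite ler_wpM2r ?mulr_ge0 ?invr_ge0 //.
  apply: le_trans (_ : lg (2 ^ X) <= _); first by rewrite le_lg ?prime_gt0 // -mem_nums.
  by rewrite lgX // -[leRHS]mulr1 ler_wpM2l // lg2_le1.
under eq_bigr => r _ do rewrite exchange_big.
rewrite exchange_big /= mulr_sumr mulr_sumr; apply: ler_sum => q _.
rewrite /avg expr2 !mulr_suml mulr_sumr mulr_sumr big_mkcond [leRHS]big_mkcond /=.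
apply: ler_sum => r _; rewrite /big; case: (prime r) => //=.
have a0 s : 0 <= c * (X%:R * ((reach k r q : nat)%:R / r%:R * ((reach k s q : nat)%:R / s%:R))).
  by rewrite !mulr_ge0 ?invr_ge0.
rewrite !mulr_sumr; case: ifP => _; last first.
  by apply: sumr_ge0 => s _.
rewrite big_mkcond [leRHS]big_mkcond; apply: ler_sum => s _.
by case: (prime s) => //=; case: ifP.
Qed.
End Spread.

Lemma avg_descend G : (forall q, 0 <= G q) -> avg (descend G) <= bt_const * avg G.
Proof. by move=> G0; rewrite avgE; exact: spread_descend spread_primes _ G0. Qed.

Lemma avg_reach k q : prime q -> (q <= 2 ^ X)%N ->
  avg (fun p => (reach k p q : nat)%:R) <= k%:R * bt_const ^+ k / q%:R.
Proof.
move=> pq qX; have B1 := bt_const_ge1; elim: k => [|k IH].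
  by rewrite !mul0r /avg big1 // => p _; rewrite mul0r.
apply: le_trans (_ : avg (fun p => (p == q : nat)%:R + descend (fun r => (reach k r q : nat)%:R) p) <= _).
  apply: avg_le => p pX pp; rewrite reachS; case: (p == q) => /=.
    by rewrite lerDl sumr_ge0.
  case E: (reach_proper k p q); last by rewrite add0r sumr_ge0.
  move/hasP: E => [r rX /andP[cr H]]; rewrite add0r /descend (big_rem r) //= cr H lerDl.
  by apply: sumr_ge0 => s _.
rewrite avgD; apply: le_trans (lerD (lexx _) (avg_descend _)) _ => //.
have -> : avg (fun p => (p == q : nat)%:R) = q%:R^-1.
  rewrite /avg big_mkcond (bigD1_seq q) ?iota_uniq ?mem_nums //= pq eqxx mul1r big1 ?addr0 //.
  by move=> p /negPf ->; rewrite mul0r; case: ifP.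
have Bk : 1 <= bt_const ^+ k.+1 by rewrite exprn_ege1.
apply: le_trans (_ : bt_const ^+ k.+1 / q%:R + bt_const * (k%:R * bt_const ^+ k / q%:R) <= _).
  apply: lerD; first by rewrite ler_peMl ?invr_ge0.
  by rewrite ler_wpM2l // (le_trans ler01).
by rewrite exprS -nat1r le_eqVlt; apply/orP; left; apply/eqP; ring.
Qed.

Definition overlap_bound k := X%:R * (k%:R * bt_const ^+ k) ^+ 2 / z%:R.

Lemma spread_overlap_le ps w c k : spread ps w c ->
  \sum_(p <- ps) w p * overlap k p <= c * overlap_bound k.
Proof.
move=> hs; apply: le_trans (spread_overlap hs k) _.
case: hs => c0 _ _ _; rewrite ler_wpM2l // /overlap_bound -mulrA ler_wpM2l //.
apply: le_trans (_ : \sum_(q <- nums | prime q && (z < q)%N) (k%:R * bt_const ^+ k) ^+ 2 * (q%:R ^+ 2)^-1 <= _).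
  rewrite big_seq_cond [leRHS]big_seq_cond; apply: ler_sum => q /andP[qX /andP[pq _]].
  rewrite mem_nums in qX; rewrite -exprVn -exprMn lerXn2r ?nnegrE //.
  - by apply: avg_ge0.
  - by rewrite !mulr_ge0 ?invr_ge0 // exprn_ge0 // (le_trans ler01 bt_const_ge1).
  - exact: avg_reach.
rewrite -mulr_sumr ler_wpM2l ?sqr_ge0 //.
have z0 : (0 < z)%N by lia.
apply: le_trans (sum_inv_sqr_le R (2 ^ X).+1 z0).
apply: (ler_sum_surj (phi := id)) => //; first exact: iota_uniq.
  by move=> q _ _; rewrite invr_ge0 sqr_ge0.
move=> q; rewrite mem_nums => qX /andP[_ zq]; exists q; split=> //.
by rewrite mem_index_iota zq.
Qed.

Lemma avg_lg_pred : avg (fun p => lg p - lg p.-1) <= 2.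
Proof.
apply: le_trans (_ : \sum_(2 <= p < (2 ^ X).+1) 2 * (p%:R ^+ 2)^-1 <= _).
  apply: (ler_sum_surj (phi := id)) => //; first exact: iota_uniq.
    by move=> q _ _; rewrite mulr_ge0 ?invr_ge0 ?sqr_ge0.
  move=> p; rewrite mem_nums => pX pp; exists p; split=> //.
    by rewrite mem_index_iota prime_gt1.
  by rewrite expr2 invfM mulrA ler_wpM2r ?invr_ge0 // lg_pred_ge // prime_gt1.
rewrite -mulr_sumr -[leRHS]mulr1 ler_wpM2l //.
by apply: le_trans (sum_inv_sqr_le _ _ _) _; rewrite ?invr1.
Qed.

Lemma overlap_ge0 k p : 0 <= overlap k p.
Proof. by do 3 (apply: sumr_ge0 => ? _); exact: lg_ge0. Qed.

Lemma lg_pred_ge0 p : 0 <= lg p - lg p.-1.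
Proof.
rewrite subr_ge0; case: p => [//|[|p]]; last by rewrite le_lg.
by rewrite /= lg1 lg0.
Qed.

Lemma deficit_ge0 k p : 0 <= deficit k p.
Proof.
elim: k p => [//|k IH] p /=; rewrite addr_ge0 ?descend_ge0 //.
by rewrite addr_ge0 ?overlap_ge0 // mulr_ge0 // addr_ge0 ?waste_ge0 ?lg_pred_ge0.
Qed.

Lemma waste_bound_ge0 : 0 <= waste_bound.
Proof. by do 2 (apply: sumr_ge0 => ? _); rewrite divr_ge0 ?lg_ge0. Qed.

Lemma overlap_bound_le j k : (j <= k)%N -> overlap_bound j <= overlap_bound k.
Proof.
have B0 := le_trans ler01 bt_const_ge1; move=> jk; rewrite /overlap_bound ler_wpM2r ?invr_ge0 //.
rewrite ler_wpM2l // lerXn2r ?nnegrE ?mulr_ge0 ?exprn_ge0 //.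
by rewrite ler_pM ?exprn_ge0 ?ler_nat // ler_weXn2l // bt_const_ge1.
Qed.

Definition level_loss k := k%:R * (bt_const * waste_bound + 2) + 1.

Lemma avg_deficit K k : bt_const * overlap_bound K <= 1 -> (k <= K)%N ->
  avg (deficit k) <= k%:R * bt_const ^+ k * level_loss K.
Proof.
move=> ovK; have B1 := bt_const_ge1; have B0 := le_trans ler01 B1; have w0 := waste_bound_ge0.
have L0 : 0 <= level_loss K by rewrite addr_ge0 // mulr_ge0 // addr_ge0 // mulr_ge0.
elim: k => [_|k IH kK].
  by rewrite !mul0r /avg big1 // => p _; rewrite mul0r.
rewrite /= avgD avgD avgZ avgD.
have h1 := avg_descend (deficit_ge0 k); have h2 := IH (ltnW kK).
have h3 : avg (fun p => waste p.-1) <= bt_const * waste_bound by rewrite avgE; exact: spread_waste spread_primes.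
have h4 := avg_lg_pred.
have h5 : avg (overlap k) <= 1.
  rewrite avgE; apply: le_trans (spread_overlap_le k spread_primes) _.
  by apply: le_trans ovK; rewrite ler_wpM2l // overlap_bound_le // ltnW.
have Bk : 1 <= bt_const ^+ k.+1 by rewrite exprn_ege1.
apply: le_trans (_ : bt_const * (k%:R * bt_const ^+ k * level_loss K) + level_loss K <= _).
  apply: lerD; first by apply: le_trans h1 _; rewrite ler_wpM2l.
  apply: lerD => //; apply: ler_pM => //.
  - by rewrite -avgD avg_ge0 // => p; rewrite addr_ge0 ?waste_ge0 ?lg_pred_ge0.
  - by rewrite ler_nat ltnW.
  - exact: lerD.
have -> : bt_const * (k%:R * bt_const ^+ k * level_loss K) = k%:R * bt_const ^+ k.+1 * level_loss K.
  by rewrite exprS; ring.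
by rewrite -natr1 mulrDl mulrDl mul1r lerD2l ler_peMl.
Qed.

Definition root_loss k n := k%:R * waste n + descend (deficit k) n.+1 + overlap k n.+1.

Lemma root_loss_ge0 k n : 0 <= root_loss k n.
Proof.
rewrite /root_loss addr_ge0 ?overlap_ge0 // addr_ge0 ?mulr_ge0 ?waste_ge0 //.
exact/descend_ge0/deficit_ge0.
Qed.

Definition total_loss k := k%:R * waste_bound + k%:R * bt_const ^+ k * level_loss k + 1.

Lemma sum_root_loss k : bt_const * overlap_bound k <= 1 ->
  \sum_(1 <= n < (2 ^ X).+1) root_loss k n <= (2 ^ X)%:R * total_loss k.
Proof.
move=> ovK; rewrite /root_loss !big_split /= -mulr_sumr /total_loss.
move: (level_loss k) (@avg_deficit k k ovK (leqnn k)) => L hL; rewrite !mulrDr.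
have E G : \sum_(1 <= n < (2 ^ X).+1) G n.+1 = \sum_(p <- roots) 1 * G p :> R.
  by rewrite big_map; apply: eq_bigr => n _; rewrite mul1r.
apply: lerD; first apply: lerD.
- rewrite mulrCA ler_wpM2l // (E (fun p => waste p.-1)); exact: spread_waste spread_roots.
- rewrite E; apply: le_trans (spread_descend spread_roots (deficit_ge0 k)) _.
  by rewrite ler_wpM2l.
- rewrite E; apply: le_trans (spread_overlap_le k spread_roots) _.
  rewrite ler_wpM2l //; apply: le_trans ovK; rewrite ler_peMl ?bt_const_ge1 //.
  by rewrite /overlap_bound divr_ge0 // mulr_ge0 // sqr_ge0.
Qed.

Lemma exists_root k : bt_const * overlap_bound k <= 1 ->
  exists n, [/\ (0 < n)%N, (2 ^ X.-1 <= n)%N, (n <= 2 ^ X)%N & root_loss k n <= 2 * total_loss k].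
Proof.
move=> ovK; have S := sum_root_loss ovK.
have [/hasP[n]|/hasPn H] := boolP (has (fun n => root_loss k n <= 2 * total_loss k)
    (index_iota (2 ^ X.-1).+1 (2 ^ X).+1)).
  by rewrite mem_index_iota => /andP[n1 n2] L; exists n; split=> //; lia.
exfalso; have EX : (2 ^ X = 2 ^ X.-1 + 2 ^ X.-1)%N by rewrite addnn -mul2n -expnS prednK.
have X0 : (0 < 2 ^ X.-1)%N by rewrite expn_gt0.
suff : (2 ^ X)%:R * total_loss k < \sum_(1 <= n < (2 ^ X).+1) root_loss k n.
  by rewrite ltNge S.
rewrite (@big_cat_nat _ _ _ (2 ^ X.-1).+1) /=; [|lia|lia].
apply: lt_le_trans (_ : \sum_((2 ^ X.-1).+1 <= i < (2 ^ X).+1) root_loss k i <= _); last first.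
  by rewrite lerDr; apply: sumr_ge0 => n _; exact: root_loss_ge0.
have -> : (2 ^ X)%:R * total_loss k = \sum_((2 ^ X.-1).+1 <= i < (2 ^ X).+1) (2 * total_loss k).
  by rewrite sumr_const_nat EX subSS addnK natrD -[RHS]mulr_natl; ring.
apply: ltr_sum_nat => [|n nI]; first by lia.
by rewrite ltNge; apply: H; rewrite mem_index_iota.
Qed.

End Descent.

(** * From the tree to the values of [f] *)

Lemma sum_geometric_le (F : realFieldType) (q m n : nat) : (1 < q)%N ->
  \sum_(m <= a < n) (q%:R ^+ a)^-1 <= 2 * (q%:R ^+ m)^-1 :> F.
Proof.
move=> q1; have q0 : (0 : F) < q%:R by rewrite ltr0n; lia.
have q2 : (2 : F) <= q%:R by rewrite ler_nat.
have [mn|nm] := leqP m n; last by rewrite big_geq ?mulr_ge0 ?invr_ge0 ?exprn_ge0 // ltnW.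
apply: le_trans (_ : \sum_(m <= a < n) (- (2 * (q%:R ^+ a.+1)^-1) - - (2 * (q%:R ^+ a)^-1)) <= _).
  apply: ler_sum => a _; rewrite exprS invfM.
  have : q%:R^-1 <= 2^-1 :> F by rewrite lef_pV2 ?posrE.
  have : 0 <= (q%:R ^+ a)^-1 :> F by rewrite invr_ge0 exprn_ge0 // ltW.
  move: (_ ^-1) (q%:R^-1) => u v; nra.
rewrite (telescope_sumr (fun a => - (2 * (q%:R ^+ a)^-1))) // opprK gerDr oppr_le0.
by rewrite mulr_ge0 ?invr_ge0 ?exprn_ge0 // ltW.
Qed.

Lemma waste_bound_le X Y : (0 < Y)%N -> (X <= 2 ^ Y)%N ->
  waste_bound X (2 ^ Y) <= 2 * Y%:R * (1 + Y%:R) + 2.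
Proof.
move=> Y0 XY; set z := (2 ^ Y)%N.
have z1 : (1 < z)%N by rewrite /z -(ltn_exp2l 0 Y (leqnn 2)) in Y0 *.
apply: le_trans (_ : \sum_(q <- nums X | prime q && (q <= z)%N) 2 * lg z * q%:R^-1 +
   \sum_(q <- nums X | prime q && (z < q)%N) 2 * X%:R * (q%:R ^+ 2)^-1 <= _).
  rewrite /waste_bound (bigID (fun q => (q <= z)%N)) /=; apply: lerD.
    apply: ler_sum => q /andP[pq qz]; rewrite qz /=.
    under eq_bigr => a _ do rewrite natrX.
    rewrite -mulr_sumr mulrAC [leRHS]mulrC; apply: ler_pM; rewrite ?lg_ge0 //.
    - by apply: sumr_ge0 => a _; rewrite invr_ge0 exprn_ge0.
    - by rewrite le_lg ?prime_gt0.
    by apply: le_trans (sum_geometric_le _ _ _ (prime_gt1 pq)) _; rewrite expr1 mulrC.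
  under eq_bigl => q do rewrite -ltnNge.
  rewrite big_seq_cond [leRHS]big_seq_cond; apply: ler_sum => q /andP[qX /andP[pq zq]].
  rewrite mem_nums in qX; rewrite leqNgt zq /=.
  under eq_bigr => a _ do rewrite natrX.
  rewrite -mulr_sumr mulrAC [leRHS]mulrC; apply: ler_pM; rewrite ?lg_ge0 //.
  - by apply: sumr_ge0 => a _; rewrite invr_ge0 exprn_ge0.
  - apply: le_trans (_ : lg (2 ^ X) <= _); first by rewrite le_lg ?prime_gt0.
    by rewrite lgX // -[leRHS]mulr1 ler_wpM2l // lg2_le1.
  apply: le_trans (sum_geometric_le _ 2 X.+1 (prime_gt1 pq)).
  apply: (ler_sum_surj (phi := id)) => //; first exact: iota_uniq.
    by move=> a _ _; rewrite invr_ge0 exprn_ge0.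
  move=> a; rewrite !mem_index_iota => /andP[_ aX] a1; exists a; split=> //.
  by rewrite mem_index_iota a1.
apply: lerD.
  rewrite -mulr_sumr -mulrA -[leRHS]mulrA ler_wpM2l //; apply: ler_pM.
  - exact: lg_ge0.
  - by apply: sumr_ge0 => q _; rewrite invr_ge0.
  - by rewrite /z lgX // -[leRHS]mulr1 ler_wpM2l // lg2_le1.
  apply: le_trans (harmonic_pow2_le R Y); apply: (ler_sum_surj (phi := id)) => //.
  - exact: iota_uniq.
  - by move=> q _ _; rewrite invr_ge0.
  move=> q _ /andP[pq qz]; exists q; split=> //.
  by rewrite mem_index_iota prime_gt0.
rewrite -mulr_sumr -mulrA -[leRHS]mulr1 ler_wpM2l //.
apply: le_trans (_ : X%:R * z%:R^-1 <= _); last first.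
  by rewrite ler_pdivrMr ?ltr0n 1?ltnW // mul1r ler_nat.
rewrite ler_wpM2l //; apply: le_trans (sum_inv_sqr_le R (2 ^ X).+1 (ltnW z1)).
apply: (ler_sum_surj (phi := id)) => //; first exact: iota_uniq.
  by move=> q _ _; rewrite invr_ge0 sqr_ge0.
move=> q; rewrite mem_nums => qX /andP[_ zq]; exists q; split=> //.
by rewrite mem_index_iota zq.
Qed.

Lemma dvdn_prod_primes (s : seq nat) (a : pred nat) k : all prime s -> uniq s ->
  (forall q, q \in s -> a q -> (q %| k)%N) -> (\prod_(q <- s | a q) q %| k)%N.
Proof.
elim: s => [|q r IH] /=; first by rewrite big_nil dvd1n.
move=> /andP[pq pr] /andP[qr ur] H; rewrite big_cons.
have IHr : (\prod_(q <- r | a q) q %| k)%N.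
  by apply: IH => // t tr; apply: H; rewrite inE tr orbT.
case: ifP => // aq; rewrite Gauss_dvd ?IHr ?andbT ?H ?mem_head //.
rewrite -big_filter coprime_prod_primes // ?mem_filter ?(negPf qr) ?andbF //.
by apply/allP => t; rewrite mem_filter => /andP[_ /(allP pr)].
Qed.

Section PrimeProduct.
Variable s : seq nat.
Hypotheses (s_prime : all prime s) (s_uniq : uniq s).
Notation m := (\prod_(p <- s) p)%N.

Lemma mem_primes_prod p : (p \in primes m) = (p \in s).
Proof.
rewrite mem_primes (prod_primes_gt0 s_prime) /=; apply/andP/idP => [[pp]|ps]; last first.
  by rewrite (allP s_prime) // (big_rem p) //= dvdn_mulr.
apply: contraLR => ps; rewrite -prime_coprime //; exact: coprime_prod_primes.
Qed.

Lemma perm_primes_prod : perm_eq (primes m) s.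
Proof. by apply: uniq_perm; rewrite ?primes_uniq // => p; rewrite mem_primes_prod. Qed.

Lemma rad_prod : Defs.rad m = m.
Proof. by rewrite /Defs.rad (perm_big s) //= perm_primes_prod. Qed.

Lemma logn_prod p : p \in s -> logn p m = 1%N.
Proof.
move=> ps; have pp := allP s_prime _ ps.
have sr : all prime (rem p s) by apply/allP => q /mem_rem /(allP s_prime).
rewrite (big_rem p) //= lognM ?(prod_primes_gt0 sr) ?(prime_gt0 pp) // logn_prime // eqxx.
by rewrite logn_coprime // coprime_prod_primes // mem_rem_uniqF.
Qed.

Lemma f_fun_prod : f_fun m = gcdn m (delta m * carmichael m).
Proof. by rewrite /f_fun rad_prod mulnK // totient_gt0 prod_primes_gt0. Qed.

Lemma dvdn_carmichael_prod p q : p \in s -> (q %| p.-1)%N -> (q %| carmichael m)%N.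
Proof.
move=> ps qp; rewrite /carmichael (perm_big s) /=; last exact: perm_primes_prod.
rewrite (big_rem p) //= logn_prod //; apply: dvdn_trans (dvdn_lcml _ _).
by rewrite /carmichael_pp andbF subnn /= mul1n subn1.
Qed.

Lemma f_fun_prod_ge n : (0 < n)%N ->
  (forall q, q \in s -> (q %| n)%N \/ exists2 p, p \in s & (q %| p.-1)%N) ->
  (m <= f_fun m * n)%N.
Proof.
move=> n0 hs.
rewrite [leqLHS](bigID (fun q => (q %| n)%N)) /= mulnC; apply: leq_mul.
  rewrite f_fun_prod; apply: dvdn_leq; first by rewrite gcdn_gt0 prod_primes_gt0.
  rewrite dvdn_gcd; apply/andP; split; apply: dvdn_prod_primes => // q qs qn.
    by rewrite (big_rem q) //= dvdn_mulr.
  case: (hs q qs) => [H|[p ps qp]]; first by rewrite H in qn.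
  by rewrite dvdn_mull // (dvdn_carmichael_prod ps).
by apply: dvdn_leq => //; apply: dvdn_prod_primes.
Qed.
End PrimeProduct.

Lemma exists_large_f X Y k : (0 < X)%N -> (2 <= Y)%N ->
  bt_const X * overlap_bound X (2 ^ Y) k <= 1 ->
  exists m, [/\ (0 < m)%N,
    k%:R * (X.-1%:R * lg 2) - 2 * total_loss X (2 ^ Y) k <= lg m,
    lg m <= k%:R * (X%:R * lg 2) & lg m - X%:R * lg 2 <= lg (f_fun m)].
Proof.
move=> X0 Y2; set z := (2 ^ Y)%N => ov.
have z4 : (4 <= z)%N by rewrite -[4%N]/(2 ^ 2)%N /z leq_exp2l.
have [n [n0 n1 n2 L]] := exists_root X0 z4 ov.
pose s := [seq q <- nums X | reach_proper X z k n.+1 q].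
have hs q : q \in s -> [/\ prime q, (z < q)%N & (q < n.+1)%N].
  by rewrite mem_filter => /andP[H _]; apply: reach_proper_prime H.
have sp : all prime s by apply/allP => q /hs[].
have s2 q : q \in s -> (2 < q)%N by case/hs=> _ zq _; lia.
have su : uniq s by rewrite filter_uniq ?iota_uniq.
set m := (\prod_(q <- s) q)%N.
have m0 : (0 < m)%N by exact: prod_primes_gt0.
have lgm : lg m = height_proper X z k n.+1.
  by rewrite /m lg_prod ?big_filter // => q /hs[pq _ _] _; rewrite prime_gt0.
have lgn1 : X.-1%:R * lg 2 <= lg n by rewrite -lgX // le_lg ?expn_gt0.
have lgn2 : lg n <= X%:R * lg 2 by rewrite -lgX // le_lg.
exists m; split=> //.
- rewrite lgm; apply: le_trans (height_proper_root_ge X0 z4 k n0 n2).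
  by rewrite lerB // ler_wpM2l.
- by rewrite lgm; apply: le_trans (height_proper_root_le X0 z4 k n0 n2) _; rewrite ler_wpM2l.
have F : (m <= f_fun m * n)%N.
  apply: f_fun_prod_ge => // q; rewrite mem_filter => /andP[/hasP[r rX /andP[cr H]] qX].
  case: (reach_parent H) => [<-|[p [rp /and3P[_ _ qp]]]]; first by left; case/and3P: cr.
  right; exists p => //; have Hp : reach_proper X z k n.+1 p by apply/hasP; exists r; rewrite ?cr.
  rewrite mem_filter Hp mem_nums.
  by have [_ _] := reach_proper_prime X0 z4 (n0 : (1 < n.+1)%N) Hp; rewrite ltnS => /leq_trans->.
have f0 : (0 < f_fun m)%N by rewrite /f_fun gcdn_gt0 m0.
rewrite lerBlDr; apply: le_trans (_ : lg (f_fun m * n) <= _); first exact: le_lg.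
by rewrite lgM // lerD2l.
Qed.

Lemma natr_overlap_le (F : numDomainType) (u : F) (c x j : nat) : 0 <= u -> u <= c%:R ->
  u * (x%:R * (j%:R * u ^+ j) ^+ 2) <= (c * (x * (j * c ^ j) ^ 2))%:R.
Proof.
move=> u0 uc; have uj : u ^+ j <= c%:R ^+ j by rewrite lerXn2r ?nnegrE.
rewrite natrM natrM natrX natrM natrX ler_pM ?mulr_ge0 ?exprn_ge0 ?mulr_ge0 ?exprn_ge0 //.
by rewrite ler_wpM2l // lerXn2r ?nnegrE ?mulr_ge0 ?exprn_ge0 // ler_wpM2l.
Qed.

Lemma natr_total_loss_le (F : numDomainType) (u w : F) (c v j : nat) :
  0 <= u -> u <= c%:R -> 0 <= w -> w <= v%:R ->
  j%:R * w + j%:R * u ^+ j * (j%:R * (u * w + 2) + 1) + 1 <=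
  (j * v + j * c ^ j * (j * (c * v + 2) + 1) + 1)%:R.
Proof.
move=> u0 uc w0 wv; have uj : u ^+ j <= c%:R ^+ j by rewrite lerXn2r ?nnegrE.
have uw : u * w <= c%:R * v%:R by rewrite ler_pM.
rewrite !natrD !natrM natrX natrD natrM natrD natrM lerD2r lerD ?ler_wpM2l //.
apply: ler_pM; rewrite ?mulr_ge0 ?exprn_ge0 ?addr_ge0 ?mulr_ge0 ?addr_ge0 ?mulr_ge0 ?ler_wpM2l //.
by rewrite lerD2r ler_wpM2l // lerD2r.
Qed.

Section Scales.
Variable t : nat.
(* With [k = 2 ^ (t ^ 2)] levels and [X = 2 ^ ((t ^ 2 + t) k)], the constant
   [bt_const X = O(t ^ 2 * k)] is at most [2 ^ (t ^ 2 + t - 1)] for large [t], so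
   that its [k]-th power is at most [X / 2 ^ k]; and [z = X ^ 4]. *)
Definition depth := (2 ^ (t ^ 2))%N.
Definition log_size := ((t ^ 2 + t) * depth)%N.
Hypothesis t20 : (20 <= t)%N.
Notation k := depth.
Notation e := log_size.
Notation b := (128 * e)%N.
Notation X := (2 ^ e)%N.

Lemma pow2_ge_quadratic n : (20 <= n)%N -> (128 * (n ^ 2 + n) <= 2 ^ n.-1)%N.
Proof.
elim: n => // n IH; rewrite leq_eqVlt => /orP[/eqP <- //|]; rewrite ltnS => n20 /=.
have := IH n20; have -> : (2 ^ n.+1.-1 = 2 * 2 ^ n.-1)%N by rewrite -expnS prednK //; lia.
have : (20 * n <= n * n)%N by rewrite leq_mul2r n20 orbT.
by rewrite -!mulnn [(n.+1 * n.+1)%N]mulSn mulnS; move: (2 ^ n.-1)%N (n * n)%N => p q; lia.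
Qed.

Lemma sqr_le_pow2 n : (4 <= n)%N -> (n ^ 2 <= 2 ^ n)%N.
Proof.
elim: n => // n IH; rewrite leq_eqVlt => /orP[/eqP <- //|]; rewrite ltnS => n4.
rewrite [leqRHS]expnS; have := IH n4; have : (4 * n <= n * n)%N by rewrite leq_mul2r n4 orbT.
by rewrite -!mulnn [(n.+1 * n.+1)%N]mulSn mulnS; move: (2 ^ n)%N (n * n)%N => p q; lia.
Qed.

Lemma depth_gt0 : (0 < k)%N. Proof. by rewrite expn_gt0. Qed.
Lemma log_size_gt0 : (0 < e)%N.
Proof. by rewrite muln_gt0 depth_gt0 andbT; lia. Qed.

Lemma base_pow_le : (b ^ k * 2 ^ k <= X)%N.
Proof.
rewrite -expnMn /log_size expnM leq_exp2r ?depth_gt0 //.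
have H := pow2_ge_quadratic t20.
rewrite expnD mulnA mulnAC [leqRHS]mulnC leq_mul2r; apply/orP; right.
by apply: leq_trans (leq_mul H (leqnn 2)) _; rewrite mulnC -expnS prednK //; lia.
Qed.

Lemma depth_large : (2 ^ 15 * k * e ^ 3 * (8 * t) <= 2 ^ k)%N.
Proof.
have H := pow2_ge_quadratic t20.
have e1 : (e <= 2 ^ (t + t ^ 2))%N.
  rewrite expnD leq_mul2r; apply/orP; right; apply: leq_trans (_ : 2 ^ t.-1 <= _)%N.
    by apply: leq_trans H; lia.
  by rewrite leq_exp2l // leq_pred.
have t1 : (t <= 2 ^ t)%N by rewrite ltnW // ltn_expl.
apply: leq_trans (_ : 2 ^ 15 * 2 ^ (t ^ 2) * (2 ^ (t + t ^ 2)) ^ 3 * (2 ^ 3 * 2 ^ t) <= _)%N.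
  by rewrite !leq_mul // leq_exp2r.
rewrite -expnM -!expnD leq_exp2l //.
have : (t ^ 2 * t ^ 2 <= k)%N.
  by rewrite mulnn sqr_le_pow2 // (leq_exp2r 2 t (isT : (0 < 2)%N)); lia.
apply: leq_trans; rewrite -!mulnn; nia.
Qed.

Lemma bt_const_le_base : bt_const X <= b%:R.
Proof.
apply: le_trans (ler_wpM2l _ (harmonic_pow2_le R e)) _ => //.
rewrite nat1r -natrM ler_nat; have := log_size_gt0; lia.
Qed.

Lemma overlap_bound_parameters : bt_const X * overlap_bound X (2 ^ (4 * e)) k <= 1.
Proof.
have X0 : (0 < X)%N by rewrite expn_gt0.
have B1 := bt_const_ge1 X0; have B0 := le_trans ler01 B1.
rewrite /overlap_bound mulrA ler_pdivrMr ?ltr0n ?expn_gt0 // mul1r.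
apply: le_trans (_ : (b * (X * (k * b ^ k) ^ 2))%:R <= _).
  by apply: natr_overlap_le => //; exact: bt_const_le_base.
rewrite ler_nat.
have H := base_pow_le; have k0 := depth_gt0; have b0 : (0 < b)%N by have := log_size_gt0; lia.
have bX : (b <= X)%N.
  apply: leq_trans H; apply: leq_trans (_ : b ^ k <= _)%N; last by rewrite leq_pmulr ?expn_gt0.
  by rewrite -{1}[b]expn1 leq_pexp2l.
have kX : (k * b ^ k <= X)%N.
  by apply: leq_trans H; rewrite mulnC leq_mul2l ltnW ?orbT // ltn_expl.
have -> : (2 ^ (4 * e) = X * (X * X ^ 2))%N by rewrite -expnM -!expnD; congr expn; lia.
by rewrite !leq_mul // leq_exp2r.
Qed.

Lemma total_loss_parameters :
  (16 * t)%:R * total_loss X (2 ^ (4 * e)) k <= k%:R * X%:R.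
Proof.
have X0 : (0 < X)%N by rewrite expn_gt0.
have e0 := log_size_gt0; have k0 := depth_gt0.
have B1 := bt_const_ge1 X0; have B0 := le_trans ler01 B1; have Bb := bt_const_le_base.
set wb := (42 * e ^ 2)%N.
have hw : waste_bound X (2 ^ (4 * e)) <= wb%:R.
  apply: le_trans (waste_bound_le _ _) _; [lia|by rewrite leq_exp2l //; lia|].
  rewrite nat1r -!natrM -natrD ler_nat /wb -mulnn; nia.
have w0 := waste_bound_ge0 X (2 ^ (4 * e)).
pose T := (k * wb + k * b ^ k * (k * (b * wb + 2) + 1) + 1)%N.
apply: le_trans (_ : (16 * t * T)%:R <= _).
  by rewrite [leRHS]natrM ler_wpM2l // /T /total_loss /level_loss natr_total_loss_le.
rewrite -natrM ler_nat.
have HX := base_pow_le; have HK := depth_large.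
have p0 : (0 < b ^ k)%N by rewrite expn_gt0; apply/orP; left; lia.
have l1 : (k * (b * wb + 2) + 1 <= k * (b * (45 * e ^ 2)))%N.
  rewrite /wb -mulnn; nia.
have l2 : (T <= 88 * k ^ 2 * b ^ k * (128 * e ^ 3))%N.
  rewrite /T /wb; apply: leq_trans (_ : k * (42 * e ^ 2) + k * b ^ k * (k * (b * (45 * e ^ 2))) + 1 <= _)%N.
    by rewrite leq_add2r leq_add2l leq_mul2l l1 orbT.
  move: (b ^ k)%N p0 => p p0; move: k k0 e e0 => K K0 E E0.
  have -> : (E ^ 3 = E * (E * E))%N by rewrite !expnS expn0 muln1.
  rewrite -!mulnn.
  have E20 : (0 < E * E)%N by rewrite muln_gt0 E0.
  move: (E * E)%N E20 => E2 E20; pose W := (K * K * p * (E * E2))%N.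
  have W1 : (K * E2 <= W)%N.
    by apply: leq_mul; [rewrite -mulnA leq_pmulr ?muln_gt0 ?K0 | rewrite leq_pmull].
  have W0 : (0 < W)%N by rewrite !muln_gt0 K0 p0 E0.
  have -> : (K * p * (K * (128 * E * (45 * E2))) = 128 * 45 * W)%N by rewrite /W; ring.
  have -> : (88 * (K * K) * p * (128 * (E * E2)) = 88 * 128 * W)%N by rewrite /W; ring.
  clearbody W; rewrite [(K * (42 * _))%N]mulnCA; move: (K * E2)%N W1 => V; lia.
apply: leq_trans (leq_mul (leqnn _) l2) _.
apply: leq_trans (_ : k * b ^ k * (2 ^ 15 * k * e ^ 3 * (8 * t)) <= _)%N.
  rewrite -[(k ^ 2)%N]mulnn; move: (b ^ k)%N (e ^ 3)%N => p q.
  have -> : (16 * t * (88 * (k * k) * p * (128 * q)) = k * k * p * q * t * (16 * 88 * 128))%N by ring.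
  have -> c : (k * p * (c * k * q * (8 * t)) = k * k * p * q * t * (c * 2 ^ 3))%N by ring.
  rewrite leq_mul2l (_ : 2 ^ 15 * 2 ^ 3 = 2 ^ 4 * 2 ^ 7 * 2 ^ 7)%N; last by rewrite -!expnD.
  by rewrite !leq_mul ?orbT.
by apply: leq_trans (leq_mul (leqnn _) HK) _; rewrite -mulnA leq_mul2l HX orbT.
Qed.
End Scales.

Lemma lg2_ge : 2^-1 <= lg 2.
Proof.
have := @ln_le_subr1 (2^-1)%R; rewrite invr_gt0 ltr0n => /(_ isT).
have -> : ln (2^-1)%R = - lg 2 by apply: ln_Rinv; apply/RltP; rewrite ltr0n.
by move: (lg 2) => l; lra.
Qed.

Lemma ler_ln (x y : R) : 0 < x -> x <= y -> ln x <= ln y.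
Proof.
move=> x0; rewrite le_eqVlt => /orP[/eqP-> //|xy].
by apply/ltW/RltP/ln_increasing; apply/RltP.
Qed.

Definition extremal t m :=
  let K := depth t in let X := (2 ^ log_size t)%N in
  [/\ (0 < m)%N, (1 - t%:R^-1) * (K%:R * X%:R * lg 2) <= lg m,
     lg m <= K%:R * X%:R * lg 2 & lg m - X%:R * lg 2 <= lg (f_fun m)].

Lemma exists_extremal t : (20 <= t)%N -> exists m, extremal t m.
Proof.
move=> t20; have e0 := log_size_gt0 t20.
have X0 : (0 < 2 ^ log_size t)%N by rewrite expn_gt0.
have Y2 : (2 <= 4 * log_size t)%N by lia.
have [m [m0 m1 m2 m3]] := exists_large_f X0 Y2 (overlap_bound_parameters t20).
exists m; split=> //; last by rewrite -mulrA.
apply: le_trans m1; have := total_loss_parameters t20.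
have tX : 2 * t%:R <= (2 ^ log_size t)%:R :> R.
  rewrite -natrM ler_nat; apply: leq_trans (_ : 2 ^ t <= _)%N.
    have := ltn_expl t.-1 (isT : (1 < 2)%N).
    have -> : (2 ^ t = 2 * 2 ^ t.-1)%N by rewrite -expnS (ltn_predK t20).
    by move: (2 ^ t.-1)%N => p; lia.
  by rewrite leq_exp2l // /log_size; have := depth_gt0 t; nia.
have k0 : 0 < (depth t)%:R :> R by rewrite ltr0n depth_gt0.
have t0 : 0 < t%:R :> R by rewrite ltr0n; lia.
have -> : (2 ^ log_size t).-1%:R = (2 ^ log_size t)%:R - 1 :> R.
  by rewrite -[in RHS](prednK X0) -natr1 addrK.
rewrite natrM; move: lg2_ge lg2_le1 tX k0 t0.
move: (lg 2) (total_loss _ _ _) ((2 ^ log_size t)%:R) ((depth t)%:R) (t%:R) => l T x k u.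
move=> l1 l2 ux k0 u0 H.
rewrite -(ler_pM2l u0).
have -> : u * ((1 - u^-1) * (k * x * l)) = (u - 1) * (k * x * l) by field; rewrite lt0r_neq0.
have kl : 0 <= k * l by rewrite mulr_ge0 ?ltW //; lra.
have x0 : 0 <= x by apply: le_trans ux; rewrite mulr_ge0 // ltW.
have kx : 0 <= k * x by rewrite mulr_ge0 // ltW.
have h1 : k * l * (2 * u) <= k * l * x by rewrite ler_wpM2l.
have h2 : k * x * 2^-1 <= k * x * l by rewrite ler_wpM2l.
lra.
Qed.

Section Extremal.
Variables t m : nat.
Hypotheses (t20 : (20 <= t)%N) (mP : extremal t m).

Lemma extremal_lg_ge : (2 ^ log_size t)%:R <= lg m.
Proof.
case: mP => m0 + _ _; apply: le_trans.
have k4 : 4 <= (depth t)%:R :> R.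
  rewrite ler_nat; apply: (@leq_trans (2 ^ 2)%N) => //.
  by rewrite /depth leq_exp2l // -mulnn; nia.
have x0 : 0 <= (2 ^ log_size t)%:R :> R by [].
have u : t%:R^-1 <= 2^-1 :> R by rewrite lef_pV2 ?posrE ?ltr0n ?ler_nat; lia.
move: lg2_ge k4 x0 u.
move: (lg 2) ((2 ^ log_size t)%:R) ((depth t)%:R) (t%:R^-1) => l x k u l1 k4 x0 u1.
have h1 : 4 * x <= k * x by rewrite ler_wpM2r.
have h2 : k * x * 2^-1 <= k * x * l by rewrite ler_wpM2l // mulr_ge0 //; lra.
have h3 : 2^-1 * (k * x * l) <= (1 - u) * (k * x * l).
  rewrite ler_wpM2r ?mulr_ge0 //; lra.
lra.
Qed.

Lemma extremal_lnlg : (log_size t)%:R * lg 2 <= ln (lg m) /\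
  ln (lg m) <= (t ^ 2 + log_size t)%:R * lg 2.
Proof.
have H := extremal_lg_ge; have X0 : 0 < (2 ^ log_size t)%:R :> R by rewrite ltr0n expn_gt0.
rewrite -!lgX //; split; first exact: ler_ln.
apply: ler_ln; first exact: lt_le_trans H.
case: mP => _ _ + _ => /le_trans; apply; rewrite expnD natrM -[leRHS]mulr1.
by rewrite ler_wpM2l ?lg2_le1 // mulr_ge0.
Qed.

Lemma extremal_lnlnlg : (t ^ 2)%:R * lg 2 <= ln (ln (lg m)).
Proof.
have [H _] := extremal_lnlg; rewrite -lgX //; apply: ler_ln.
  by rewrite ltr0n expn_gt0.
apply: le_trans H; rewrite /log_size natrM mulrAC -[leLHS]mul1r ler_wpM2r //.
have : 2 <= (t ^ 2 + t)%:R :> R by rewrite ler_nat; lia.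
by have := lg2_ge; move: (lg 2) ((t ^ 2 + t)%:R) => l u; nra.
Qed.

Lemma extremal_ratio :
  [/\ 0 < lg m, 0 < ln (lg m), 0 < ln (ln (lg m)) &
   (lg m - lg (f_fun m)) * ln (lg m) / (lg m * ln (ln (lg m))) - 1 <= 3 / t.-1%:R].
Proof.
have l12 := lg2_ge; have l0 : 0 < lg 2 by apply: lt_le_trans l12; rewrite invr_gt0 ltr0n.
have [H1 H2] := extremal_lnlg; have H3 := extremal_lnlnlg.
have X0 : 0 < (2 ^ log_size t)%:R :> R by rewrite ltr0n expn_gt0.
have e0 : 0 < (log_size t)%:R :> R by rewrite ltr0n log_size_gt0.
have u0 : 0 < (t ^ 2)%:R :> R by rewrite ltr0n expn_gt0; lia.
have p0 : 0 < lg m := lt_le_trans X0 extremal_lg_ge.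
have p1 : 0 < ln (lg m) by apply: lt_le_trans H1; rewrite mulr_gt0.
have p2 : 0 < ln (ln (lg m)) by apply: lt_le_trans H3; rewrite mulr_gt0.
split=> //.
have v0 : 0 < t.-1%:R :> R by rewrite ltr0n; lia.
have tE : t%:R = t.-1%:R + 1 :> R by rewrite natr1 prednK //; lia.
rewrite lerBlDr ler_pdivrMr ?mulr_gt0 //.
case: mP => m0 m1 m2 m3.
have k0 : 0 < (depth t)%:R :> R by rewrite ltr0n depth_gt0.
have tk : t%:R <= (depth t)%:R :> R.
  rewrite ler_nat ltnW // (leq_ltn_trans _ (ltn_expl (t ^ 2) _)) //.
  by rewrite -mulnn leq_pmulr // (leq_trans _ t20).
apply: le_trans (_ : ((2 ^ log_size t)%:R * lg 2) * ((t ^ 2 + log_size t)%:R * lg 2) <= _).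
  apply: le_trans (_ : ((2 ^ log_size t)%:R * lg 2) * ln (lg m) <= _).
    by apply: (ler_wpM2r (ltW p1)); rewrite lerBlDr -lerBlDl.
  by rewrite ler_wpM2l // mulr_ge0 // ltW.
apply: le_trans (_ : (3 / t.-1%:R + 1) *
   (((1 - t%:R^-1) * ((depth t)%:R * (2 ^ log_size t)%:R * lg 2)) * ((t ^ 2)%:R * lg 2)) <= _); last first.
  rewrite ler_wpM2l ?addr_ge0 ?divr_ge0 // ler_pM ?mulr_ge0 //; try exact: ltW.
  by rewrite subr_ge0 invf_le1 ?ltr0n ?ler1n (leq_trans _ t20).
have E : (t ^ 2 + log_size t)%:R = t%:R ^+ 2 + (t%:R ^+ 2 + t%:R) * (depth t)%:R :> R.
  by rewrite natrD /log_size natrM natrD natrX.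
rewrite E [(t ^ 2)%:R]natrX tE; rewrite tE in tk.
move: (t.-1%:R) (depth t)%:R ((2 ^ log_size t)%:R) (lg 2) v0 k0 X0 l0 tk => v k x l v0 k0 X0 l0 tk.
have -> : (3 / v + 1) * ((1 - (v + 1)^-1) * (k * x * l) * ((v + 1) ^+ 2 * l)) =
   x * l * l * ((v + 3) * (v + 1) * k).
  by field; rewrite !lt0r_neq0 // addr_gt0.
have -> : x * l * (((v + 1) ^+ 2 + ((v + 1) ^+ 2 + (v + 1)) * k) * l) =
   x * l * l * ((v + 1) ^+ 2 + ((v + 1) ^+ 2 + (v + 1)) * k) by ring.
have xl : 0 <= x * l * l by rewrite !mulr_ge0 // ltW.
apply: (ler_wpM2l xl).
have vk : (v + 1) * (v + 1) <= (v + 1) * k by rewrite ler_wpM2l // addr_ge0 // ltW.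
lra.
Qed.
End Extremal.

Lemma extremal_le t T m : (t <= T)%N -> extremal t m ->
  (m <= 2 ^ (depth T * 2 ^ log_size T))%N.
Proof.
move=> tT [m0 _ m2 _]; rewrite leqNgt; apply/negP => H.
have d : (depth t <= depth T)%N by rewrite leq_exp2l // leq_exp2r.
have e : (log_size t <= log_size T)%N by rewrite leq_mul // leq_add // leq_exp2r.
have : lg (2 ^ (depth T * 2 ^ log_size T)) < lg m.
  by apply/RltP/ln_increasing; apply/RltP; rewrite ?ltr0n ?expn_gt0 // ltr_nat.
rewrite ltNge lgX // natrM (le_trans m2) // ler_wpM2r ?lg_ge0 //.
by rewrite ler_pM // ler_nat // leq_exp2l.
Qed.

(* The least nonnegative [epsilon] for which the required inequality holds. *)
Definition exponent_error m : R :=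
  Num.max 0%R ((lg m - lg (f_fun m)) * ln (lg m) / (lg m * ln (ln (lg m))) - 1)%R.

Lemma large_f_family : exists M : nat -> Prop,
  [/\ forall m, M m -> (0 < m)%N,
      forall N : nat, exists m, M m /\ (N <= m)%N,
      forall e : R, 0 < e -> exists N : nat, forall m, M m -> (N <= m)%N -> `|exponent_error m| < e
    & forall m, M m -> (1 - (1 + exponent_error m) * ln (ln (lg m)) / ln (lg m)) * lg m <= lg (f_fun m)].
Proof.
exists (fun m => exists2 t, (20 <= t)%N & extremal t m); split.
- by move=> m [t _ []].
- move=> N; pose t := maxn 20 N; have t20 : (20 <= t)%N by rewrite leq_maxl.
  have [m mP] := exists_extremal t20; exists m; split; first by exists t.
  have m0 : (0 < m)%N by case: mP.
  rewrite -(ler_nat R); apply: le_trans (_ : lg m <= _); last first.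
    by apply: le_trans (ln_le_subr1 _) _; rewrite ?ltr0n // gerBl.
  apply: le_trans (extremal_lg_ge t20 mP); rewrite ler_nat.
  apply: leq_trans (leq_maxr 20 N) _; rewrite -/t ltnW // (leq_ltn_trans _ (ltn_expl (log_size t) _)) //.
  by rewrite /log_size; have := depth_gt0 t; nia.
- move=> e e0; pose T := (Num.bound (3 / e)).+1.
  exists (2 ^ (depth T * 2 ^ log_size T)).+1 => m [t t20 mP] Nm.
  have Tt : (T < t)%N.
    by rewrite ltnNge; apply/negP => /extremal_le /(_ mP); rewrite leqNgt Nm.
  have [_ _ _ H] := extremal_ratio t20 mP.
  rewrite ger0_norm ?le_max ?lexx // /exponent_error gt_max e0 /=.
  apply: le_lt_trans H _; rewrite ltr_pdivrMr ?ltr0n; last by lia.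
  rewrite mulrC -ltr_pdivrMr //; apply: lt_le_trans (archi_boundP _) _; first by rewrite divr_ge0 // ltW.
  by rewrite ler_nat; move: Tt; rewrite /T; move: (Num.bound _) => c Tt; lia.
move=> m [t t20 mP]; have [p0 p1 p2 _] := extremal_ratio t20 mP.
have : (lg m - lg (f_fun m)) * ln (lg m) / (lg m * ln (ln (lg m))) - 1 <= exponent_error m.
  by rewrite le_max lexx orbT.
move: (exponent_error m) (lg (f_fun m)) (lg m) (ln (lg m)) (ln (ln (lg m))) p0 p1 p2 => u g l a b l0 a0 b0.
rewrite lerBlDr ler_pdivrMr ?mulr_gt0 // => H.
rewrite mulrBl mul1r lerBlDr -lerBlDl mulrAC ler_pdivlMr //.
by apply: le_trans H _; rewrite le_eqVlt; apply/orP; left; apply/eqP; ring.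
Qed.

(** * The upper bound for [d] *)

Definition chained (s : seq nat) (root : pred nat) :=
  forall q, q \in s -> ~~ root q -> exists2 p, p \in s & (q %| p.-1)%N.

Lemma chained_max s root : all prime s -> chained s root -> s != [::] ->
  exists2 p, p \in s & root p /\ {in s, forall q, (q <= p)%N}.
Proof.
move=> sp cs; case: s sp cs => // q0 s sp cs _.
pose p := foldr maxn 0%N (q0 :: s).
have pmax : {in q0 :: s, forall q, (q <= p)%N}.
  move=> q; rewrite /p; elim: (q0 :: s) => //= r l IH; rewrite inE leq_max.
  by case/orP=> [/eqP->|/IH ->]; rewrite ?leqnn ?orbT.
have ps : p \in q0 :: s.
  rewrite /p; elim: s q0 {sp cs p pmax} => [|r l IH] q /=; first by rewrite maxn0 mem_head.
  by rewrite /maxn; case: ifP => _; [rewrite inE IH orbT | rewrite mem_head].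
exists p => //; split=> //; apply: contraT => np.
have [r rs pr] := cs p ps np; have := pmax r rs.
have r1 := prime_gt1 (allP sp r rs); have := dvdn_leq _ pr; lia.
Qed.

(* Removing the largest prime [p] turns the prime divisors of [p - 1] into
   roots; as these are odd and [p - 1] is even, the product of the roots drops
   at least by a factor 2. *)
Lemma chained_lg_prod_le s root : all prime s -> {in s, forall p, (2 < p)%N} -> uniq s ->
  chained s root ->
  2 * lg 2 * lg (\prod_(q <- s) q) <=
    lg (\prod_(q <- s | root q) q) * (lg (\prod_(q <- s | root q) q) + lg 2).
Proof.
have [n] := ubnP (size s); elim: n s root => // n IH s root sn sp s2 su cs.
have [->|s0] := eqVneq s [::]; first by rewrite !big_nil lg1 mulr0 mul0r.
have [p ps [rp pmax]] := chained_max sp cs s0.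
have pp := allP sp p ps; set s' := rem p s.
have s's q : q \in s' -> q \in s by exact: mem_rem.
have s'p q : q \in s' -> q != p.
  by move=> qs; apply: contraTneq qs => ->; rewrite mem_rem_uniqF.
have sp' : all prime s' by apply/allP => q /s's /(allP sp).
have su' : uniq s' by exact: rem_uniq.
pose root' q := root q || (q %| p.-1)%N.
have cs' : chained s' root'.
  move=> q qs; rewrite negb_or => /andP[nr nq]; have [r rs qr] := cs q (s's q qs) nr.
  exists r => //; rewrite /s' mem_rem_uniq // inE rs andbT.
  by apply: contraNneq nq => <-.
have sn' : (size s' < n)%N by rewrite size_rem //; case: (s) s0 sn => //= ? ?; lia.
have := IH s' root' sn' sp' (fun q qs => s2 q (s's q qs)) su' cs'.
set a' := (\prod_(q <- s' | root' q) q)%N; set a := (\prod_(q <- s | root q) q)%N.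
have prod_gt0 r (c : pred nat) : all prime r -> (0 < \prod_(q <- r | c q) q)%N.
  move=> rp'; rewrite big_seq_cond; apply: prodn_cond_gt0 => q /andP[/(allP rp') pq _].
  exact: prime_gt0.
have aE : a = (p * \prod_(q <- s' | root q) q)%N by rewrite /a (big_rem p ps) /= rp.
have a'E : a' = (\prod_(q <- s' | root q) q * \prod_(q <- s' | root' q && ~~ root q) q)%N.
  rewrite /a' (bigID root) /=; congr (_ * _)%N; apply: eq_bigl => q.
  by rewrite /root'; case: (root q); rewrite ?andbF.
have even_p : (2 %| p.-1)%N.
  have [p2|op] := even_prime pp; first by have := s2 p ps; rewrite p2.
  by rewrite dvdn2 -subn1 oddB ?prime_gt0 // op.
have half : (2 * \prod_(q <- s' | root' q && ~~ root q) q <= p.-1)%N.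
  apply: dvdn_leq; first by have := prime_gt1 pp; lia.
  rewrite Gauss_dvd ?even_p /=; last first.
    rewrite -big_filter coprime_prod_primes //.
      by apply/allP => q; rewrite mem_filter => /andP[_ /(allP sp')].
    by rewrite mem_filter; apply/negP => /andP[_ /s's/s2].
  by apply: dvdn_prod_primes => // q _ /andP[/orP[->|]].
have a'0 : (0 < a')%N := prod_gt0 s' root' sp'.
have le_a : (2 * a' <= a)%N.
  rewrite a'E aE mulnCA mulnC leq_mul2r (leq_trans half (leq_pred p)) orbT //.
have le_p : (p <= a)%N by rewrite aE leq_pmulr // prod_gt0.
have -> : lg (\prod_(q <- s) q) = lg p + lg (\prod_(q <- s') q).
  by rewrite (big_rem p ps) /= lgM ?(prod_primes_gt0 sp') // prime_gt0.
have h1 : lg p <= lg a by rewrite le_lg ?prime_gt0.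
have h2 : lg 2 + lg a' <= lg a by rewrite -lgM // le_lg ?muln_gt0.
have h3 := lg_ge0 a'; have h4 := lg_ge0 2.
move: (lg (\prod_(q <- s') q)) (lg p) (lg a) (lg a') (lg 2) h1 h2 h3 h4 => x y u v l h1 h2 h3 h4 h5.
have h6 : v * (v + l) <= (u - l) * u by rewrite ler_pM ?addr_ge0 //; lra.
have h7 : l * y <= l * u by rewrite ler_wpM2l.
lra.
Qed.

Lemma lg_d_fun_le m : (0 < m)%N -> lg (d_fun m) * lg 2 <= lg (m %/ d_fun m) ^+ 2.
Proof.
move=> m0; set d := d_fun m; set n := (m %/ d)%N.
have d0 : (0 < d)%N by rewrite gcdn_gt0 m0.
have mE : m = (d * n)%N by rewrite mulnC divnK // dvdn_gcdl.
have n0 : (0 < n)%N by move: m0; rewrite mE muln_gt0 d0.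
pose s := [seq p <- primes m | p != 2%N].
have sp : all prime s by apply/allP => p; rewrite mem_filter => /andP[_ /(allP (all_prime_primes m))].
have s2 : {in s, forall p, (2 < p)%N}.
  move=> p ps; have := prime_gt1 (allP sp p ps); move: ps; rewrite mem_filter => /andP[/eqP]; lia.
have su : uniq s by rewrite filter_uniq // primes_uniq.
have sm p : p \in s -> (p %| m)%N by rewrite mem_filter mem_primes => /and4P[].
have phi : totient (Defs.rad m) = (\prod_(p <- s) p.-1)%N.
  have ap := all_prime_primes m; have up := primes_uniq m.
  rewrite totientE ?prod_primes_gt0 // /Defs.rad (perm_big (primes m)) /=; last exact: perm_primes_prod.
  rewrite big_filter (bigID (fun p => p != 2%N)) /= [X in (_ * X)%N]big1_seq ?muln1.
    rewrite big_seq_cond [RHS]big_seq_cond; apply: eq_bigr => p /andP[pm _].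
    by rewrite logn_prod // expn0 muln1.
  by move=> p /andP[/negPn/eqP-> pm]; rewrite logn_prod.
have dphi : (d %| delta m * \prod_(p <- s) p.-1)%N by rewrite -phi dvdn_gcdr.
have cs : chained s (fun q => q %| n)%N.
  move=> q qs nq; have pq := allP sp q qs; have q2 := s2 q qs.
  have : (q %| delta m * \prod_(p <- s) p.-1)%N.
    apply: dvdn_trans dphi; move: (sm q qs); rewrite {1}mE Euclid_dvdM //.
    by rewrite (negPf nq) orbF.
  rewrite Euclid_dvdM // => /orP[|]; first by rewrite /delta; case: ifP => _ /dvdn_leq; lia.
  rewrite Euclid_dvd_prod // big_has => /hasP[p ps qp]; by exists p.
have d_le : (d <= delta m * \prod_(p <- s) p.-1)%N.
  apply: dvdn_leq dphi; rewrite muln_gt0 -phi totient_gt0 prod_primes_gt0 ?all_prime_primes //.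
  by rewrite /delta; case: ifP.
have small p : p \in s -> (p <= n)%N.
  have [->|s0] := eqVneq s [::]; first by [].
  have [r rs [rn rmax]] := chained_max sp cs s0.
  by move=> /rmax /leq_trans; apply; rewrite dvdn_leq.
have sprod : (\prod_(p <- s) p.-1 <= \prod_(p <- s) p)%N.
  by apply: leq_prod => p _; exact: leq_pred.
have main : 2 * lg 2 * lg (\prod_(p <- s) p) <= lg n * (lg n + lg 2).
  apply: le_trans (chained_lg_prod_le sp s2 su cs) _.
  have h : lg (\prod_(q <- s | (q %| n)%N) q) <= lg n.
    apply: le_lg; last by apply: dvdn_leq => //; apply: dvdn_prod_primes.
    rewrite big_seq_cond; apply: prodn_cond_gt0 => q /andP[/(allP sp) pq _]; exact: prime_gt0.
  by apply: ler_pM; rewrite ?addr_ge0 ?lg_ge0 ?lerD2r.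
have s_pos : (0 < \prod_(p <- s) p)%N by exact: prod_primes_gt0.
have n_lg c : (2 ^ c <= n)%N -> c%:R * lg 2 <= lg n.
  by move=> cn; rewrite -lgX // le_lg ?expn_gt0.
have l0 := lg_ge0 2; have t0 := lg_ge0 n; have S0 := lg_ge0 (\prod_(p <- s) p).
move: d_le; rewrite /delta; case: ifP => m4 d_le.
  have [n4|n4] := leqP 4 n.
    have h : lg d <= lg 2 + lg (\prod_(p <- s) p).
      by rewrite -lgM // le_lg // (leq_trans d_le) // leq_mul2l sprod.
    have := n_lg 2 n4.
    move: (lg d) (lg (\prod_(p <- s) p)) (lg n) (lg 2) main h l0 t0 => x u t l main h l0 t0 h2.
    have ? : x * l <= (l + u) * l by rewrite ler_wpM2r.
    have ? : 0 <= (t - 2 * l) * (t + l) by rewrite mulr_ge0 ?subr_ge0 // addr_ge0.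
    rewrite expr2; lra.
  have [n3|n3] := leqP 3 n.
    have n3E : n = 3%N by lia.
    have d4 : (d <= 2 ^ 2)%N.
      apply: leq_trans d_le _; rewrite leq_mul2l /=; move: su small s2.
      case: (s) => [|p [|q r]] /=; rewrite ?big_nil // ?big_seq1.
        by move=> _ /(_ p); rewrite inE eqxx => /(_ isT); lia.
      move=> /andP[pq _] sm' s2'.
      have := sm' p; have := sm' q; have := s2' p; have := s2' q.
      rewrite !inE !eqxx ?orbT /= => /(_ isT) q3 /(_ isT) p3 /(_ isT) q4 /(_ isT) p4.
      by move: pq; rewrite inE negb_or => /andP[/eqP]; lia.
    have h : lg d <= 2 * lg 2 by rewrite -lgX // le_lg.
    have h3 : 3 * lg 2 <= 2 * lg n by rewrite n3E -!lgX // le_lg.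
    move: (lg d) (lg n) (lg 2) h h3 l0 t0 => x t l h h3 l0 t0.
    have ? : x * l <= (2 * l) * l by rewrite ler_wpM2r.
    have ? : (3 * l) * (3 * l) <= (2 * t) * (2 * t) by rewrite ler_pM ?mulr_ge0.
    have ? : 0 <= l * l by rewrite mulr_ge0.
    rewrite expr2; lra.
  have sE : s = [::].
    case E : s => [//|p r]; have := small p; have := s2 p; rewrite E mem_head => /(_ isT) ? /(_ isT).
    lia.
  rewrite sE big_nil muln1 in d_le.
  have n2 : (2 <= n)%N.
    rewrite ltnNge; apply/negP => n1; have nE : n = 1%N by lia.
    by move: m4; rewrite mE nE muln1 => /dvdn_leq; lia.
  have h : lg d <= lg 2 by rewrite le_lg.
  have := n_lg 1%N n2; rewrite mul1r => h2; rewrite expr2.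
  by apply: ler_pM; rewrite ?lg_ge0 // (le_trans h).
have h : lg d <= lg (\prod_(p <- s) p).
  by rewrite le_lg // (leq_trans d_le) // mul1n.
have [n2|n1] := leqP 2 n.
  have := n_lg 1%N n2; rewrite mul1r.
  move: (lg d) (lg (\prod_(p <- s) p)) (lg n) (lg 2) main h l0 t0 => x u t l main h l0 t0 h2.
  have ? : x * l <= u * l by rewrite ler_wpM2r.
  have ? : t * l <= t * t by rewrite ler_wpM2l.
  rewrite expr2; lra.
have nE : n = 1%N by lia.
move: main; rewrite nE lg1 mul0r expr0n /= => main.
have H : lg d * lg 2 <= lg (\prod_(p <- s) p) * lg 2 by rewrite ler_wpM2r.
move: (lg d) (lg (\prod_(p <- s) p)) (lg 2) main H => x u l main H.
lra.
Qed.

Local Close Scope ring_scope.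
(* From here on [%R] delimits [R_scope]. *)
From mathcomp Require Import all_boot.
From Stdlib Require Import Reals Psatz.

Lemma exp_monotone (x y : R) : (x <= y)%R -> (exp x <= exp y)%R.
Proof. by case=> [xy|->]; [left; exact: exp_increasing | right]. Qed.

Lemma ln_le_mul_exp_sqrt (l a b : R) : (0 <= l)%R -> (0 <= b)%R -> (a * l <= b ^ 2)%R ->
  (a <= l / 2 + (a + b) + - sqrt (l * (a + b) + l ^ 2 / 4))%R.
Proof.
move=> l0 b0 H.
suff : (sqrt (l * (a + b) + l ^ 2 / 4) <= b + l / 2)%R by Lra.lra.
rewrite -[X in (_ <= X)%R]sqrt_pow2; last Lra.lra.
by apply: sqrt_le_1_alt; Psatz.nra.
Qed.

Theorem theorem1p1 :
  (forall m : nat, (1 <= m)%nat ->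
     (INR (d_fun m) <=
      sqrt 2 * INR m *
      exp (- sqrt (ln 2 * ln (INR m) + (ln 2) ^ 2 / 4)))%R)
  /\
  (exists (M : nat -> Prop) (eps : nat -> R),
     (forall m, M m -> (0 < m)%nat) /\
     (forall N : nat, exists m, M m /\ (N <= m)%nat) /\
     (forall e : R, (0 < e)%R ->
        exists N : nat, forall m, M m -> (N <= m)%nat -> (Rabs (eps m) < e)%R) /\
     (forall m, M m -> (0 < ln (ln (INR m)))%R ->
        (Rpower (INR m)
           (1 - (1 + eps m) * ln (ln (ln (INR m))) / ln (ln (INR m))) <=
         INR (f_fun m))%R)).
Proof.
have lgE n : lg n = ln (INR n) by rewrite /lg INRE.
have INR_pos n : (0 < n)%nat -> (0 < INR n)%R by move/ltP/lt_0_INR.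
split=> [m m0|].
  have d0 : (0 < d_fun m)%nat by rewrite gcdn_gt0 m0.
  have mE : m = d_fun m * (m %/ d_fun m) by rewrite mulnC divnK // dvdn_gcdl.
  have n0 : (0 < m %/ d_fun m)%nat by move: m0; rewrite {1}mE muln_gt0 d0.
  have := lg_d_fun_le m0; move/RleP; rewrite -RmultE -RpowE !lgE.
  have lm : ln (INR m) = (ln (INR (d_fun m)) + ln (INR (m %/ d_fun m)))%R.
    by rewrite {1}mE mult_INR ln_mult //; exact: INR_pos.
  have l0 : (0 < ln 2)%R by rewrite -ln_1; apply: ln_increasing; Lra.lra.
  have y0 : (0 <= ln (INR (m %/ d_fun m)))%R by rewrite -lgE; apply/RleP/lg_ge0.
  have -> : INR 2 = 2%R by [].
  move=> /(ln_le_mul_exp_sqrt (Rlt_le _ _ l0) y0); rewrite -lm => H.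
  have sqrt2 : sqrt 2 = exp (ln 2 / 2).
    by rewrite -Rpower_sqrt /Rpower; [congr exp; Lra.lra | Lra.lra].
  rewrite sqrt2 -{1}(exp_ln _ (INR_pos _ d0)) -{1}(exp_ln _ (INR_pos _ m0)) -!exp_plus.
  exact: exp_monotone.
have [M [Mpos Minf Meps Mf]] := large_f_family.
exists M, exponent_error; split=> //; split=> //; split=> [e /RltP e0|m Mm _].
  have [N H] := Meps e e0; exists N => m Mm Nm; apply/RltP; rewrite RabsE; exact: H.
have f0 : (0 < f_fun m)%nat by rewrite gcdn_gt0 Mpos.
rewrite -(exp_ln _ (INR_pos _ f0)) /Rpower; apply: exp_monotone.
by have := Mf m Mm; rewrite !lgE => /RleP.
Qed.
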